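(* Let $K_0\subset K\subset\mathbb{R}^n$ with $K_0$ a linear subspace and $K$ a closed convex cone (both depending on $n$). For any $\mu\in K$ (depending on $n$) such that $$\|\mu-\Pi_{K_0}(\mu)\|\gg\delta_K^{1/4}\wedge\left(\frac{\delta_K^{1/2}}{0\vee\inf_{\eta\in K,\,\|\eta\|=1}\langle\eta,\mathbb{E}\Pi_K(\xi)\rangle}\right),$$ it holds, as $n\to\infty$, that $$\frac{\Gamma_{K,2}(\mu-\Pi_{K_0}(\mu))}{(\delta_K-\delta_{K_0})^{1/2}}\to+\infty\qquad\text{and}\qquad\frac{\Gamma_K(\mu-\Pi_{K_0}(\mu))}{\sqrt{1-\delta_{K_0}/\delta_K}}\to+\infty.$$
   Context: $\xi$ is a standard Gaussian vector in $\mathbb{R}^n$, $\|\cdot\|$ the Euclidean norm, $\Pi_C$ the metric projection onto a closed convex set $C$. The statistical dimension of a closed convex cone $C$ is $\delta_C=\mathbb{E}\|\Pi_C(\xi)\|^2$. For $p\ge1$, $\Gamma_{K,p}(\nu)=\mathbb{E}\|\Pi_K(\nu+\xi)\|^p-\mathbb{E}\|\Pi_K(\xi)\|^p$, $\nu\in\mathbb{R}^n$, and $\Gamma_K=\Gamma_{K,1}$. For nonnegative sequences, $a_n\gg b_n$ means $a_n/b_n\to\infty$. $c/0=+\infty$ for $c>0$; $a\vee b=\max$, $a\wedge b=\min$. *)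

(* Defs.v *)
From HB Require Import structures.
From mathcomp Require Import all_boot all_order all_algebra.
From mathcomp Require Import all_classical all_reals all_analysis.

Set Implicit Arguments.
Unset Strict Implicit.
Unset Printing Implicit Defensive.

Import Order.TTheory GRing.Theory Num.Theory.
Import numFieldNormedType.Exports.

Local Open Scope classical_set_scope.
Local Open Scope ring_scope.

Definition dotv (R : realType) (n : nat) (u v : 'rV[R]_n) : R :=
  \sum_(i < n) u ord0 i * v ord0 i.

(* The library norm `|v| on 'rV[R]_n is the max norm; it induces the same
   topology, so [closed] below has its usual meaning. *)
Definition enorm (R : realType) (n : nat) (v : 'rV[R]_n) : R :=
  Num.sqrt (dotv v v).

(* Total by choice; the minimizer exists and is unique when C is nonempty,
   closed and convex. *)
Definition metric_proj (R : realType) (n : nat) (C : set 'rV[R]_n)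
    (x : 'rV[R]_n) : 'rV[R]_n :=
  xget 0 [set y | C y /\ forall z, C z -> enorm (x - y) <= enorm (x - z)].

Definition closed_convex_cone (R : realType) (n : nat) (K : set 'rV[R]_n) :=
  [/\ K !=set0, closed K, convex_set K &
      forall (t : R) (x : 'rV[R]_n), 0 <= t -> K x -> K (t *: x)].

Definition mutually_independent (R : realType) (d : measure_display)
    (T : measurableType d) (P : probability T R) (n : nat)
    (X : 'I_n -> T -> R) :=
  forall (J : {set 'I_n}) (A : 'I_n -> set R),
    (forall i, measurable (A i)) ->
    P (\bigcap_(i in [set j | j \in J]) (X i @^-1` A i)) =
    (\prod_(i in J) P (X i @^-1` A i))%E.

Definition standard_gaussian (R : realType) (d : measure_display)
    (T : measurableType d) (P : probability T R) (n : nat)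
    (xi : T -> 'rV[R]_n) :=
  let coord i w := xi w ord0 i in
  [/\ forall i, measurable_fun [set: T] (coord i),
      forall i (A : set R), measurable A ->
        P (coord i @^-1` A) = normal_prob 0 1 A &
      mutually_independent P coord].

(* The expectations below are finite for a standard Gaussian xi and a closed
   convex cone K, so [fine] loses nothing. *)
Definition stat_dim (R : realType) (d : measure_display)
    (T : measurableType d) (P : probability T R) (n : nat)
    (xi : T -> 'rV[R]_n) (K : set 'rV[R]_n) : R :=
  fine 'E_P[fun w => enorm (metric_proj K (xi w)) ^+ 2].

Definition mean_proj (R : realType) (d : measure_display)
    (T : measurableType d) (P : probability T R) (n : nat)
    (xi : T -> 'rV[R]_n) (K : set 'rV[R]_n) : 'rV[R]_n :=
  \row_i fine 'E_P[fun w => metric_proj K (xi w) ord0 i].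

Definition Gamma (R : realType) (d : measure_display)
    (T : measurableType d) (P : probability T R) (n : nat)
    (xi : T -> 'rV[R]_n) (K : set 'rV[R]_n) (p : R) (nu : 'rV[R]_n) : R :=
  fine 'E_P[fun w => enorm (metric_proj K (nu + xi w)) `^ p] -
  fine 'E_P[fun w => enorm (metric_proj K (xi w)) `^ p].

(* Extended division: c / 0 = +oo for c > 0, 0 / 0 = 0 and c / +oo = 0. *)
Definition much_greater (R : realType) (a b : nat -> \bar R) :=
  (a n / b n)%E @[n --> \oo] --> +oo%E.

(* The infimum over the empty set (K = {0}) is +oo. *)
Definition threshold (R : realType) (d : measure_display)
    (T : measurableType d) (P : probability T R) (n : nat)
    (xi : T -> 'rV[R]_n) (K : set 'rV[R]_n) : \bar R :=
  let delta := stat_dim P xi K in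
  let m := ereal_inf [set (dotv eta (mean_proj P xi K))%:E
                     | eta in [set eta | K eta /\ enorm eta = 1]] in
  Order.min (delta `^ (1 / 4))%:E
            ((delta `^ (1 / 2))%:E / Order.max 0%:E m)%E.

(* Main.v *)
Require Import Defs.
From HB Require Import structures.
From mathcomp Require Import all_boot all_order all_algebra.
From mathcomp Require Import all_classical all_reals all_analysis.
From mathcomp Require Import measurable_realfun ring lra.

Set Implicit Arguments.
Unset Strict Implicit.
Unset Printing Implicit Defensive.

Import Order.TTheory GRing.Theory Num.Theory.
Import numFieldNormedType.Exports.

Local Open Scope classical_set_scope.
Local Open Scope ring_scope.

(** The power of the cone is bounded below by testing the dual formula
[|Pi_K x|^2 = sup_(z in K) (2 <x, z> - |z|^2)] (half of it is
[sqr_enorm_proj_ge]) at well chosen points of [K]. Write [nu] for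
[mu - Pi_K0 mu], which lies in [K] and is orthogonal to [K0]. At
[x = nu + xi], the test points [nu + Pi_K xi] and [Pi_K xi] give, after taking
means, [Gamma_2(nu) >= |nu|^2] and [Gamma_2(nu) >= 2 <nu, E Pi_K xi>]
([Gamma2_ge_sqr], [Gamma2_ge_dotv]). The two terms of the threshold are made for
these two bounds: if [|nu|] exceeds [M] times the threshold, then
[Gamma_2(nu) >= 2 M sqrt(delta_K)] ([Gamma2_ge_threshold]). As
[delta_K - delta_K0 <= delta_K], the first limit follows as soon as the
denominator is known to be positive. It is, because [K] contains the orthogonal
sum of [K0] and of the half-line through [nu], which raises the statistical
dimension by a positive absolute constant ([stat_dim_gap]); in particular
[delta_K] is bounded away from zero.

For the power of order one, the function [x |-> |Pi_K (nu + x)|] is 1-Lipschitz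
and convex, and its variance is at most an absolute constant [V]
([gaussian_variance_le]). Hence [E |Pi_K (nu + xi)|] is at least
[sqrt(delta_K + Gamma_2(nu) - V)], whereas [E |Pi_K xi| <= sqrt(delta_K)]
([Gamma1_ge]). With [Gamma_2(nu) >= 2 M sqrt(delta_K)] and [delta_K] bounded
below, the difference tends to infinity with [M], and the denominator
[sqrt(1 - delta_K0 / delta_K)] is at most one.

The variance bound is a Gaussian Poincare inequality with a non-optimal
constant, obtained by rotating a pair of independent copies [X, Y]. Let [v(t)] be
the mean square of [f(X) - f(cos t X + sin t Y)]; then [v(pi/2)] is twice the
variance. Planar reflections preserve the law of [(X, Y)], so the two halves of
an arc contribute equally and [v(2 t) <= 4 v(t)] ([increment_doubling]). For a
small angle, a subgradient [u(X)] of [f] is independent of [Y], so [v(t)] is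
bounded by a multiple of [t^2] up to a term of order [n t^4]
([increment_sqr_le]). Halving the angle often enough makes the latter negligible
([increment_independent_le]).

The law of a Gaussian vector is handled through its values on boxes, which
determine the mean of every continuous function of at most quadratic growth; the
reflection invariance reduces to that of the planar Gaussian measure
([normal_prob_reflection]). *)

(** * One-dimensional Gaussian measure *)

Lemma ge0_integral_normal_prob (R : realType) (f : R -> \bar R) :
  measurable_fun [set: R] f -> (forall x, 0 <= f x)%E ->
  (\int[normal_prob 0 1]_x f x =
   \int[lebesgue_measure]_x (f x * (normal_pdf 0 1 x)%:E))%E.
Proof.
move=> mf f0.
have dom := normal_prob_dominates (0 : R) 1.
rewrite -(Radon_Nikodym_SigmaFinite.change_of_variables dom)//.
apply: ae_eq_integral => //.
- apply: emeasurable_funM => //.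
  exact: measurable_int (Radon_Nikodym_SigmaFinite.f_integrable dom).
- apply: emeasurable_funM => //.
  by apply/measurable_EFinP; exact: measurable_normal_pdf.
- apply: ae_eqe_mul2l; apply: integral_ae_eq => //.
  + exact: Radon_Nikodym_SigmaFinite.f_integrable.
  + by apply/measurable_EFinP; exact: measurable_normal_pdf.
  + by move=> E _ mE; rewrite -Radon_Nikodym_SigmaFinite.f_integral.
Qed.

Lemma normal_prob_opp (R : realType) (A : set R) : measurable A ->
  normal_prob 0 1 (-%R @^-1` A) = normal_prob 0 1 A.
Proof.
move=> mA; rewrite /normal_prob.
have mpdf : measurable_fun [set: R] (EFin \o normal_pdf (0 : R) 1).
  by apply/measurable_EFinP; exact: measurable_normal_pdf.
transitivity (\int[pushforward lebesgue_measure (-%R : _ -> measurableTypeR R)]_(x in A)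
    (normal_pdf 0 1 x)%:E)%E.
  rewrite [RHS]ge0_integral_pushforward; first last.
  - by move=> x _; rewrite lee_fin normal_pdf_ge0.
  - exact: measurable_funTS.
  - exact: mA.
  - exact: oppr_measurable.
  apply: eq_integral => x _ /=.
  by rewrite !normal_pdfE ?oner_neq0// /normal_fun !subr0 sqrrN.
by apply: eq_measure_integral => //= B mB _; exact: lebesgue_measureN.
Qed.

Lemma ge0_integral_affine (R : realType) (a b : R) (f : R -> \bar R) :
  0 < a -> measurable_fun [set: R] f -> (forall x, 0 <= f x)%E ->
  (a%:E * \int[lebesgue_measure]_x f (a * x + b)%R = \int[lebesgue_measure]_x f x)%E.
Proof.
move=> a0 mf f0.
pose phi : R -> measurableTypeR R := fun x => a * x + b.
have mphi : measurable_fun [set: measurableTypeR R] phi.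
  by apply: measurable_funD => //; exact: mulrl_measurable.
pose m1 : {measure set (measurableTypeR R) -> \bar R} :=
  pushforward lebesgue_measure phi.
pose m2 : {measure set (measurableTypeR R) -> \bar R} :=
  mscale (NngNum (ltW a0)) (m1 mphi).
have pE (A : set R) : measurable A -> lebesgue_measure A = m2 A.
  move=> mA; apply: (lebesgue_measure_unique (mu := m2)) => // _ [[p q]] _ <-.
  have phiE : phi @^-1` `]p, q]%classic = `](p - b) / a, (q - b) / a]%classic.
    apply/seteqP; split => x /=; rewrite !in_itv/= /phi.
      by move=> /andP[h1 h2]; rewrite ltr_pdivrMr// ler_pdivlMr//; apply/andP; split; lra.
    by rewrite ltr_pdivrMr// ler_pdivlMr// => /andP[h1 h2]; apply/andP; split; lra.
  change (lebesgue_measure `]p, q]%classic = a%:E * lebesgue_measure (phi @^-1` `]p, q]))%E.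
  rewrite phiE !lebesgue_measure_itv/= !lte_fin.
  rewrite ltr_pM2r ?invr_gt0// ltrD2r; case: ifP => _; last by rewrite mule0.
  by rewrite -!EFinB -EFinM; congr EFin; field; rewrite gt_eqF.
rewrite [RHS](@eq_measure_integral _ _ _ _ m2); last by move=> A mA _; exact: pE.
rewrite ge0_integral_mscale//=; congr (_ * _)%E.
by rewrite ge0_integral_pushforward.
Qed.

(** Splitting the planar Gaussian density along the new axes uses that a
reflection preserves the Euclidean norm; the change of variables is carried out
one coordinate at a time. *)
Lemma normal_prob_reflection (R : realType) (c s : R) (A B : set R) :
  0 < s -> c ^+ 2 + s ^+ 2 = 1 -> measurable A -> measurable B ->
  (normal_prob (0 : R) 1 \x normal_prob (0 : R) 1)%E
    [set z | A (c * z.1 + s * z.2) /\ B (s * z.1 - c * z.2)] =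
  (normal_prob 0 1 A * normal_prob 0 1 B)%E.
Proof.
move=> s0 cs mA mB.
pose phi : R -> R := normal_pdf 0 1.
have mphi : measurable_fun [set: R] phi by exact: measurable_normal_pdf.
have phi0 x : 0 <= phi x by exact: normal_pdf_ge0.
have phiE x : phi x = normal_peak 1 * expR (- (x ^+ 2) / 2).
  by rewrite /phi normal_pdfE ?oner_neq0// /normal_fun subr0 expr1n.
pose G (u v : R) : \bar R := (\1_A u * phi u * (\1_B v * phi v))%:E.
have G0 u v : (0 <= G u v)%E by rewrite lee_fin !mulr_ge0.
set E := [set z | _].
have mlin : measurable_fun [set: R * R] (fun z => (c * z.1 + s * z.2, s * z.1 - c * z.2)).
  apply/measurable_fun_pairP; split => /=.
  - by apply: measurable_funD; apply: measurable_funM.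
  - by apply: measurable_funB; apply: measurable_funM.
have mE : measurable E.
  have -> : E = setT `&` (fun z => (c * z.1 + s * z.2, s * z.1 - c * z.2)) @^-1` (A `*` B).
    by rewrite setTI.
  by apply: mlin => //; exact: measurableX.
have mG : measurable_fun [set: R * R] (fun z => G z.1 z.2).
  apply/measurable_EFinP; apply: measurable_funM; apply: measurable_funM => /=.
  - by apply: measurableT_comp => //; exact: measurable_indic.
  - exact: measurableT_comp.
  - by apply: measurableT_comp => //; exact: measurable_indic.
  - exact: measurableT_comp.
have intN (C : set R) : measurable C ->
    normal_prob 0 1 C = (\int[@lebesgue_measure R]_x (\1_C x * phi x)%:E)%E.
  move=> mC; rewrite /normal_prob integral_mkcond; apply: eq_integral => x _.
  by rewrite patchE indicE; case: ifP; rewrite ?mul1r ?mul0r.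
transitivity (\int[@lebesgue_measure R]_x \int[@lebesgue_measure R]_y
    G (c * x + s * y)%R (s * x - c * y)%R)%E.
  rewrite /product_measure1.
  rewrite ge0_integral_normal_prob; last 2 first.
  - exact: measurable_fun_xsection.
  - by [].
  apply: eq_integral => x _ /=; rewrite intN; last exact: measurable_xsection.
  rewrite -ge0_integralZr//; last 3 first.
  - apply/measurable_EFinP; apply: measurable_funM => //.
    by apply: measurable_indic; exact: measurable_xsection.
  - by move=> y _; rewrite lee_fin mulr_ge0.
  - by rewrite lee_fin normal_pdf_ge0.
  apply: eq_integral => y _; rewrite /G -EFinM; congr EFin.
  rewrite !indicE mem_xsection.
  have -> : (normal_pdf 0 1 x) = phi x by [].
  have nrm : phi x * phi y = phi (c * x + s * y) * phi (s * x - c * y).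
    rewrite !phiE mulrACA [RHS]mulrACA -!expRD; congr (_ * expR _).
    have -> : - x ^+ 2 / 2 + - y ^+ 2 / 2 = - ((c ^+ 2 + s ^+ 2) * (x ^+ 2 + y ^+ 2)) / 2.
      by rewrite cs; field.
    by field.
  have -> : ((x, y) \in E)%:R = (c * x + s * y \in A)%:R * (s * x - c * y \in B)%:R :> R.
    rewrite -natrM mulnb; congr (_%:R); congr nat_of_bool.
    apply/idP/andP => [|[]]; rewrite !inE//=.
  transitivity ((c * x + s * y \in A)%:R * (s * x - c * y \in B)%:R * (phi x * phi y)).
    by ring.
  by rewrite nrm; ring.
have mcu : measurable_fun [set: R * R] (fun z => (z.1, (z.2 - c * z.1) / s)).
  apply/measurable_fun_pairP; split => /=.
    exact: measurable_fst.
  apply: measurable_funM => //; apply: measurable_funB => //.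
  by apply: measurable_funM.
(* For fixed [x] the first new coordinate replaces [y]; once the integrals are
exchanged, the second one replaces [x]. *)
pose K : R * R -> \bar R := fun z => G z.1 ((z.2 - c * z.1) / s)%R.
have K0 z : (0 <= K z)%E by exact: G0.
have mK : measurable_fun [set: R * R] K.
  exact: (measurableT_comp mG mcu).
have step1 x : (\int[@lebesgue_measure R]_y G (c * x + s * y)%R (s * x - c * y)%R =
    s^-1%:E * fubini_G (@lebesgue_measure R) K x)%E.
  rewrite /fubini_G -(@ge0_integral_affine _ s (c * x)
    (fun u => G u ((x - c * u) / s)%R))//; last first.
    have mp : measurable_fun [set: R] (fun u : R => (u, x)).
      by apply: measurable_fun_pair; [exact: measurable_id|exact: measurable_cst].
    exact: (measurableT_comp mK mp).
  rewrite muleA -EFinM mulVf ?gt_eqF// mul1e; apply: eq_integral => y _.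
  congr (G _ _); first by rewrite addrC.
  have -> : s * x = (c ^+ 2 + s ^+ 2) / s * x - c ^+ 2 / s * x.
    by field; rewrite gt_eqF.
  by rewrite cs; field; rewrite gt_eqF.
under eq_integral do rewrite step1.
rewrite ge0_integralZl//; last 3 first.
- exact: (measurable_fun_fubini_tonelli_G (m1 := @lebesgue_measure R) K).
- by move=> x _; apply: integral_ge0.
- by rewrite lee_fin invr_ge0 ltW.
rewrite -(fubini_tonelli (m1 := @lebesgue_measure R) (m2 := @lebesgue_measure R) K)//.
rewrite -(@ge0_integralZl _ _ _ (@lebesgue_measure R) setT measurableT
  (fubini_F (@lebesgue_measure R) K))//; last 3 first.
- exact: (measurable_fun_fubini_tonelli_F (m2 := @lebesgue_measure R) K).
- by move=> x _; apply: integral_ge0.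
- by rewrite lee_fin invr_ge0 ltW.
apply: etrans (esym (congr2 mule (intN A mA) (intN B mB))).
rewrite -(@ge0_integralZr _ _ _ (@lebesgue_measure R) setT measurableT
  (fun u => (\1_A u * phi u)%:E)); last 3 first.
- by apply/measurable_EFinP; apply: measurable_funM => //; exact: measurable_indic.
- by move=> x _; rewrite lee_fin mulr_ge0.
- by apply: integral_ge0 => x _; rewrite lee_fin mulr_ge0.
apply: eq_integral => u _; rewrite /fubini_F /=.
rewrite -(@ge0_integralZl _ _ _ (@lebesgue_measure R) setT measurableT
  (fun v => (\1_B v * phi v)%:E))//; last 3 first.
- by apply/measurable_EFinP; apply: measurable_funM => //; exact: measurable_indic.
- by move=> x _; rewrite lee_fin mulr_ge0.
- by rewrite lee_fin mulr_ge0.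
rewrite -(@ge0_integral_affine _ s^-1 (- (c * u / s))
  (fun v => (\1_A u * phi u)%:E * (\1_B v * phi v)%:E)%E); last 3 first.
- by rewrite invr_gt0.
- apply: emeasurable_funM => //; apply/measurable_EFinP.
  by apply: measurable_funM => //; exact: measurable_indic.
- by move=> v; rewrite -EFinM lee_fin !mulr_ge0.
apply: (congr1 (mule _)); apply: eq_integral => x _; rewrite -EFinM.
have -> : s^-1 * x - c * u / s = (x - c * u) / s by rewrite mulrBl mulrC.
by [].
Qed.

Lemma integral_wide_gaussian (R : realType) (s : R) : 0 < s ->
  (\int[lebesgue_measure]_x (normal_peak 1 * normal_fun 0 s x)%:E = s%:E)%E.
Proof.
move=> s0.
have pk : normal_peak 1 = s * normal_peak s.
  rewrite /normal_peak expr1n -[s ^+ 2 * pi *+ 2]mulrnAr (sqrtrM _ (sqr_ge0 s)).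
  by rewrite sqrtr_sqr (gtr0_norm s0) mul1r invfM mulrA mulfV ?gt_eqF// mul1r.
transitivity (\int[lebesgue_measure]_x (s%:E * (normal_pdf 0 s x)%:E))%E.
  apply: eq_integral => x _; rewrite normal_pdfE ?gt_eqF// -EFinM.
  by rewrite pk mulrA.
rewrite ge0_integralZl//; last 3 first.
- by apply/measurable_EFinP; exact: measurable_normal_pdf.
- by move=> x _; rewrite lee_fin normal_pdf_ge0.
- by rewrite lee_fin ltW.
by rewrite integral_normal_pdf mule1.
Qed.

(** Both bounds come from [y <= expR y] and its mirror [1 - y <= expR (- y)],
which compare [x ^+ 2] times the standard density with a centred bell of another
width: width 2 for the upper bound and width 1/2 for the lower one. *)
Lemma normal_second_moment_bounds (R : realType) :
  ((1 / 3)%:E <= \int[normal_prob (0 : R) 1]_x (x ^+ 2)%:E <= (16 / 3)%:E)%E.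
Proof.
have m2 : measurable_fun [set: R] (fun x : R => (x ^+ 2)%:E).
  by apply/measurable_EFinP; exact: exprn_measurable.
have mf (s : R) : measurable_fun [set: R] (fun x => (normal_peak 1 * normal_fun 0 s x)%:E).
  by apply/measurable_EFinP; apply: measurable_funM => //; exact: measurable_normal_fun.
have pk0 := normal_peak_ge0 (1 : R).
have f0 (s : R) x : 0 <= normal_peak 1 * normal_fun 0 s x.
  by rewrite mulr_ge0// normal_fun_ge0.
rewrite ge0_integral_normal_prob//; last by move=> x; rewrite lee_fin sqr_ge0.
have pE (x : R) : normal_pdf 0 1 x = normal_peak 1 * normal_fun 0 1 x.
  by rewrite normal_pdfE ?oner_neq0.
under eq_integral do rewrite pE -EFinM.
have mm : measurable_fun [set: R]
    (fun x : R => (x ^+ 2 * (normal_peak 1 * normal_fun 0 1 x))%:E).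
  apply/measurable_EFinP; apply: measurable_funM; first exact: exprn_measurable.
  by apply: measurable_funM => //; exact: measurable_normal_fun.
apply/andP; split; last first.
  have -> : ((16 / 3)%:E = (8 / 3)%:E * (2 : R)%:E)%E by rewrite -EFinM; congr EFin; field.
  rewrite -(@integral_wide_gaussian _ 2)// -ge0_integralZl//; last 2 first.
  - exact: mf.
  - by move=> x _; rewrite lee_fin.
  apply: ge0_le_integral => //.
  - by move=> x _; rewrite lee_fin mulr_ge0 ?sqr_ge0.
  - exact: measurable_funeM (mf _).
  move=> x _; rewrite -EFinM lee_fin mulrCA [leRHS]mulrCA ler_wpM2l//.
  (* 3/8 is the difference of the exponents 1/2 and 1/8 of the two widths. *)
  have := expR_ge1Dx (3 / 8 * x ^+ 2).
  rewrite /normal_fun subr0 => h.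
  have -> : - x ^+ 2 / (2 ^+ 2 *+ 2) = 3 / 8 * x ^+ 2 + (- x ^+ 2 / (1 ^+ 2 *+ 2)) by field.
  rewrite expRD mulrA ler_wpM2r ?expR_ge0//; lra.
have h : (\int[lebesgue_measure]_x (normal_peak 1 * normal_fun 0 1 x)%:E <=
    (3 / 2)%:E * (\int[lebesgue_measure]_x (x ^+ 2 * (normal_peak 1 * normal_fun 0 1 x))%:E)
     + \int[lebesgue_measure]_x (normal_peak 1 * normal_fun 0 (1 / 2) x)%:E :> \bar R)%E.
  rewrite -ge0_integralZl//; last first.
  - by move=> x _; rewrite lee_fin mulr_ge0 ?sqr_ge0.
  rewrite -ge0_integralD//; last 4 first.
  - move=> x _; rewrite -EFinM lee_fin mulr_ge0//.
    by rewrite mulr_ge0 ?sqr_ge0.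
  - exact: measurable_funeM mm.
  - by move=> x _; rewrite lee_fin.
  - exact: mf.
  apply: ge0_le_integral => //.
  - by move=> x _; rewrite lee_fin.
  - exact: mf.
  - by apply: emeasurable_funD; [exact: measurable_funeM mm|exact: mf].
  move=> x _; rewrite -EFinM -EFinD lee_fin.
  rewrite [x ^+ 2 * _]mulrCA [3 / 2 * _]mulrCA -mulrDr ler_wpM2l// /normal_fun subr0.
  (* 3/2 is the difference of the exponents 2 and 1/2 of the two widths. *)
  have := expR_ge1Dx (- (3 / 2 * x ^+ 2)) => h.
  have -> : - x ^+ 2 / ((1 / 2) ^+ 2 *+ 2) =
      - (3 / 2 * x ^+ 2) + (- x ^+ 2 / (1 ^+ 2 *+ 2)).
    by field.
  rewrite expRD mulrA -mulrDl -[leLHS]mul1r ler_wpM2r ?expR_ge0//; lra.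
move: h; rewrite integral_wide_gaussian// integral_wide_gaussian//.
case: (\int[_]_x _)%E => [r| |] //=.
- by rewrite -EFinM -EFinD !lee_fin; lra.
- by rewrite leey.
- by rewrite gt0_muleNy ?lte_fin//; lra.
Qed.

(** * Gaussian vectors and their law *)

(** Independence and standard normal marginals in one equation on full boxes, a
form that passes to pairs of vectors and to changes of coordinates. *)
Definition gaussian_law (R : realType) d (T : measurableType d)
    (P : probability T R) n (X : T -> 'rV[R]_n) :=
  (forall i, measurable_fun [set: T] (fun w => X w ord0 i)) /\
  forall A : 'I_n -> set R, (forall i, measurable (A i)) ->
    P [set w | forall i, A i (X w ord0 i)] =
    (\prod_i normal_prob 0 1 (A i))%E.

Lemma standard_gaussian_law (R : realType) d (T : measurableType d)
    (P : probability T R) n (X : T -> 'rV[R]_n) :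
  standard_gaussian P X -> gaussian_law P X.
Proof.
move=> [mX nX iX]; split=> // A mA.
have -> : [set w | forall i, A i (X w ord0 i)] =
    \bigcap_(i in [set j | j \in [set: 'I_n]%SET]) ((fun w => X w ord0 i) @^-1` A i).
  by apply/seteqP; split => w /= h i; [move=> _; exact: h|apply: h; rewrite /= inE].
rewrite iX//; apply: eq_big => [i|i _]; first by rewrite inE.
by rewrite nX.
Qed.

Definition boxes (R : realType) n : set (set 'rV[R]_n) :=
  [set D | exists A : 'I_n -> set R, (forall i, measurable (A i)) /\
           D = [set x : 'rV[R]_n | forall i, A i (x ord0 i)]].
Arguments boxes : clear implicits.

(** A synonym of row vectors that carries the product sigma-algebra of the real
line. *)
Definition boxType (R : realType) n := g_sigma_algebraType (boxes R n).

Lemma measurable_box (R : realType) n (A : 'I_n -> set R) :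
  (forall i, measurable (A i)) ->
  measurable ([set x : 'rV[R]_n | forall i, A i (x ord0 i)] : set (boxType R n)).
Proof. by move=> mA; apply: sub_sigma_algebra; exists A. Qed.

Lemma gaussian_law_measurable (R : realType) d (T : measurableType d) n
    (X : T -> 'rV[R]_n) :
  (forall i, measurable_fun [set: T] (fun w => X w ord0 i)) ->
  measurable_fun [set: T] (X : T -> boxType R n).
Proof.
move=> mX; apply: (@measurability _ _ T (boxType R n) setT X (boxes R n)) => //.
move=> _ [D [A [mA ->]] <-]; rewrite setTI.
have -> : X @^-1` [set x | forall i, A i (x ord0 i)] =
   \big[setI/setT]_(i < n) ((fun w => X w ord0 i) @^-1` A i).
  rewrite -bigcap_seq; apply/seteqP; split => w /= h i; first by move=> _; exact: h.
  by apply: h; rewrite /= mem_index_enum.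
by apply: bigsetI_measurable => i _; rewrite -[X in measurable X]setTI; exact: mX.
Qed.

(** A continuous function is the pointwise limit of its values on finer and
finer grids, and a function of the grid point takes countably many values, each
on a box. *)
Lemma continuous_box_measurable (R : realType) n (F : 'rV[R]_n -> R) :
  continuous F -> measurable_fun [set: boxType R n] F.
Proof.
move=> cF.
pose rnd k (x : 'rV[R]_n) : 'rV[R]_n :=
  \row_i ((Num.floor (k.+1%:R * x ord0 i))%:~R / k.+1%:R).
apply: (@measurable_fun_cvg _ _ _ setT (fun k (x : boxType R n) => F (rnd k x))).
  move=> k _ B mB; rewrite setTI.
  pose cell (m : 'rV[int]_n) : set (boxType R n) :=
    [set x : 'rV[R]_n | forall i, Num.floor (k.+1%:R * x ord0 i) = m ord0 i].
  pose val (m : 'rV[int]_n) : 'rV[R]_n := \row_i ((m ord0 i)%:~R / k.+1%:R).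
  have -> : (fun x : boxType R n => F (rnd k x)) @^-1` B =
    \bigcup_j (if unpickle j is Some m then
                 (if F (val m) \in B then cell m else set0) else set0).
    apply/seteqP; split => x /=.
      move=> Bx; exists (pickle (\row_i Num.floor (k.+1%:R * x ord0 i))) => //.
      rewrite pickleK.
      have -> : val (\row_i Num.floor (k.+1%:R * (x : 'rV[R]_n) ord0 i)) = rnd k x.
        by apply/rowP => i; rewrite !mxE.
      by rewrite mem_set// => i; rewrite mxE.
    move=> [j _]; case: (unpickle j) => // m; case: ifP => // /set_mem Bm cx.
    have -> : rnd k x = val m by apply/rowP => i; rewrite !mxE cx.
    by [].
  apply: bigcupT_measurable => j; case: (unpickle j) => // m; case: ifP => // _.
  (* A cell of the grid of mesh [1 / k.+1] is a product of half-open intervals. *)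
  apply: (@measurable_box _ _ (fun i => [set y | Num.floor (k.+1%:R * y) = m ord0 i])) => i.
  have -> : [set y : R | Num.floor (k.+1%:R * y) = m ord0 i] =
      `[(m ord0 i)%:~R / k.+1%:R, ((m ord0 i) + 1)%:~R / k.+1%:R[%classic.
    apply/seteqP; split => y; rewrite /= in_itv/= ler_pdivrMr// ltr_pdivlMr//.
      move=> <-; rewrite ![y * _]mulrC.
      by rewrite ge_floor lt_succ_floor.
    by rewrite ![y * _]mulrC => /andP[h1 h2]; apply: floor_def; rewrite h1 h2.
  exact: measurable_itv.
move=> x _; apply: (@continuous_cvg _ _ _ _ _ (rnd ^~ x) F); first exact: cF.
apply/cvg_ballP => e e0; near=> k; split => // i j; rewrite ord1 mxE.
rewrite /ball/= -[X in X - _](mulfK (_ : k.+1%:R != 0 :> R))//.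
rewrite -mulrBl normrM normfV [`|k.+1%:R|]gtr0_norm// ltr_pdivrMr// [x ord0 j * _]mulrC.
have := floor_itv (k.+1%:R * (x : 'rV[R]_n) ord0 j).
rewrite intrD => /andP[h1 h2]; rewrite ger0_norm ?subr_ge0//.
rewrite (@lt_le_trans _ _ 1)//; first by rewrite ltrBlDr addrC.
rewrite -ler_pdivrMr// mul1r ltW//.
by near: k; exact: (near_infty_natSinv_lt (PosNum e0)).
Unshelve. all: by end_near. Qed.

(** Boxes form a pi-system, so the law is determined by its values on them. *)
Lemma gaussian_law_unique (R : realType) d (T : measurableType d)
    (P : probability T R) d' (T' : measurableType d') (P' : probability T' R)
    n (X : T -> 'rV[R]_n) (X' : T' -> 'rV[R]_n) (D : set (boxType R n)) :
  gaussian_law P X -> gaussian_law P' X' -> measurable D ->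
  P (X @^-1` D) = P' (X' @^-1` D).
Proof.
move=> [mX lX] [mX' lX'] mD.
pose m1 : {measure set (boxType R n) -> \bar R} :=
  pushforward P (X : T -> boxType R n).
pose m2 : {measure set (boxType R n) -> \bar R} :=
  pushforward P' (X' : T' -> boxType R n).
change (m1 (gaussian_law_measurable mX) D = m2 (gaussian_law_measurable mX') D).
have := @measure_unique _ R (boxType R n) (boxes R n) (fun=> setT).
move/(_ _ _ _ _ (m1 (gaussian_law_measurable mX)) (m2 (gaussian_law_measurable mX'))
  _ _ D mD).
apply.
- by [].
- move=> _ _ [A [mA ->]] [B [mB ->]]; exists (fun i => A i `&` B i); split.
    by move=> i; exact: measurableI.
  apply/seteqP; split => x /=; first by move=> [a b] i; split.
  by move=> ab; split => i; have [] := ab i.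
- move=> _; exists (fun=> setT); split => //.
  by apply/seteqP; split.
- by rewrite bigcup_const.
- by move=> _ [A [mA ->]]; rewrite /m1 /m2 /= /pushforward /preimage /= lX// lX'.
- move=> _; rewrite /m1 /= /pushforward preimage_setT.
  by rewrite probability_setT ltry.
Qed.

Lemma gaussian_law_integral (R : realType) d (T : measurableType d)
    (P : probability T R) d' (T' : measurableType d') (P' : probability T' R)
    n (X : T -> 'rV[R]_n) (X' : T' -> 'rV[R]_n) (F : 'rV[R]_n -> R) :
  gaussian_law P X -> gaussian_law P' X' -> continuous F ->
  (forall x, 0 <= F x) ->
  (\int[P]_w (F (X w))%:E = \int[P']_w (F (X' w))%:E)%E.
Proof.
move=> gX gX' cF F0.
have mF : measurable_fun [set: boxType R n] (EFin \o F).
  by apply/measurable_EFinP; exact: continuous_box_measurable.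
have mX := gaussian_law_measurable gX.1.
have mX' := gaussian_law_measurable gX'.1.
transitivity (\int[pushforward P (X : T -> boxType R n)]_x (F x)%:E)%E.
  by rewrite ge0_integral_pushforward// => x _; rewrite lee_fin.
transitivity (\int[pushforward P' (X' : T' -> boxType R n)]_x (F x)%:E)%E.
  apply: eq_measure_integral => // D mD _; exact: gaussian_law_unique.
by rewrite ge0_integral_pushforward// => x _; rewrite lee_fin.
Qed.

Lemma gaussian_law_pair (R : realType) d (T : measurableType d)
    (P : probability T R) d' (T' : measurableType d') (P' : probability T' R)
    m n (X : T -> 'rV[R]_m) (X' : T' -> 'rV[R]_n) :
  gaussian_law P X -> gaussian_law P' X' ->
  gaussian_law (P \x P')%E (fun w => row_mx (X w.1) (X' w.2)).
Proof.
move=> [mX lX] [mX' lX']; split.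
  move=> i; case: (split_ordP i) => j ->.
    under eq_fun do rewrite row_mxEl.
    by apply: (measurableT_comp (mX j)); exact: measurable_fst.
  under eq_fun do rewrite row_mxEr.
  by apply: (measurableT_comp (mX' j)); exact: measurable_snd.
move=> A mA.
have -> : [set w | forall i, A i ((row_mx (X w.1) (X' w.2)) ord0 i)] =
   [set w | forall i, A (lshift n i) (X w ord0 i)] `*`
   [set w | forall i, A (rshift m i) (X' w ord0 i)].
  apply/seteqP; split => w /=.
    move=> h; split => i; first by have := h (lshift n i); rewrite row_mxEl.
    by have := h (rshift m i); rewrite row_mxEr.
  move=> [h1 h2] i; case: (split_ordP i) => j ->; rewrite ?row_mxEl ?row_mxEr//.
rewrite [LHS](@product_measure1E _ _ T T' R P P'); last 2 first.
- have := measurable_box (fun i => mA (lshift n i)).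
  by move/(gaussian_law_measurable mX measurableT); rewrite setTI.
- have := measurable_box (fun i => mA (rshift m i)).
  by move/(gaussian_law_measurable mX' measurableT); rewrite setTI.
rewrite big_split_ord /=; congr (_ * _)%E.
  exact: (lX (fun i => A (lshift n i))).
exact: (lX' (fun i => A (rshift m i))).
Qed.

Lemma gaussian_law_signs (R : realType) d (T : measurableType d)
    (P : probability T R) n (X : T -> 'rV[R]_n) (e : pred 'I_n) :
  gaussian_law P X ->
  gaussian_law P (fun w => \row_i (if e i then - X w ord0 i else X w ord0 i)).
Proof.
move=> [mX lX]; split.
  move=> i; under eq_fun do rewrite mxE.
  by case: (e i); [exact: measurable_funN (mX i)|exact: mX].
move=> A mA.
have mA' i : measurable (if e i then -%R @^-1` A i else A i).
  case: (e i) => //; rewrite -[X in measurable X]setTI.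
  exact: oppr_measurable.
have -> : [set w | forall i,
    A i ((\row_i (if e i then - X w ord0 i else X w ord0 i)) ord0 i)] =
  [set w | forall i, (if e i then -%R @^-1` A i else A i) (X w ord0 i)].
  by apply/seteqP; split => w /= h i; have := h i; rewrite mxE; case: (e i).
have -> := lX (fun i => if e i then -%R @^-1` A i else A i) mA'.
apply: eq_bigr => i _; case: (e i) => //.
exact: normal_prob_opp.
Qed.

(** Conditioning on the other coordinates leaves a multiple of the planar
Gaussian measure, which is invariant under the reflection. *)
Lemma gaussian_law_reflect2 (R : realType) d (T : measurableType d)
    (P : probability T R) n (X : T -> 'rV[R]_n) (p q : 'I_n) (c s : R) :
  p != q -> 0 < s -> c ^+ 2 + s ^+ 2 = 1 -> gaussian_law P X ->
  gaussian_law P (fun w => \row_i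
    (if i == p then c * X w ord0 p + s * X w ord0 q
     else if i == q then s * X w ord0 p - c * X w ord0 q else X w ord0 i)).
Proof.
move=> pq s0 cs [mX lX]; split.
  move=> i; under eq_fun do rewrite mxE.
  case: (i == p); [|case: (i == q); [|exact: mX]].
  - by apply: measurable_funD; apply: measurable_funM.
  - by apply: measurable_funB; apply: measurable_funM.
move=> A mA.
have mB (B : 'I_n -> set R) : (forall i, measurable (B i)) ->
    measurable [set w | forall i, B i (X w ord0 i)].
  move=> h; have := gaussian_law_measurable mX measurableT (measurable_box h).
  by rewrite setTI.
pose Z w : measurableTypeR R * measurableTypeR R := (X w ord0 p, X w ord0 q).
have mZ : measurable_fun [set: T] Z.
  by apply: measurable_fun_pair; exact: mX.
have split_prod (B : 'I_n -> set R) : (\prod_i normal_prob 0 1 (B i) =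
    normal_prob 0 1 (B p) * (normal_prob 0 1 (B q) *
    \prod_(i | (i != p) && (i != q)) normal_prob (0 : R) 1 (B i)))%E.
  by rewrite (bigD1 p)//= (bigD1 q)//= eq_sym.
pose rest := (\prod_(i | (i != p) && (i != q)) normal_prob (0 : R) 1 (A i))%E.
pose B0 (C D : set R) i := if i == p then C else if i == q then D else A i.
have mB0 C D : measurable C -> measurable D -> forall i, measurable (B0 C D i).
  by move=> mC mD i; rewrite /B0; case: ifP => // _; case: ifP.
have PB0 C D : measurable C -> measurable D ->
    P [set w | forall i, B0 C D i (X w ord0 i)] =
    (normal_prob 0 1 C * (normal_prob 0 1 D * rest))%E.
  move=> mC mD; rewrite lX; last exact: mB0.
  rewrite split_prod /B0 eqxx [q == p]eq_sym (negbTE pq) eqxx.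
  congr (_ * (_ * _))%E; apply: eq_bigr => i /andP[/negbTE -> /negbTE ->].
  by [].
(* On the event [E0] the other coordinates lie in their sets; restricted to it,
the law [m'] of the selected pair is [rest] times the planar Gaussian measure. *)
pose E0 := [set w | forall i, B0 setT setT i (X w ord0 i)].
have mE0 : measurable E0 by apply: mB; exact: mB0.
have PE0 : P E0 = rest by rewrite PB0// !probability_setT !mul1e.
have rest_fin : rest = (fine rest)%:E.
  by rewrite fineK// -PE0 fin_num_measure.
have r0 : 0 <= fine rest by rewrite fine_ge0// -PE0.
pose N := mscale (NngNum r0) (normal_prob (0 : R) 1).
pose m' : {measure set (measurableTypeR R * measurableTypeR R) -> \bar R} :=
  pushforward (mrestr P mE0) Z.
have m'E (D : set (measurableTypeR R * measurableTypeR R)) : measurable D ->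
    ((fine rest)%:E * (normal_prob (0 : R) 1 \x normal_prob (0 : R) 1) D = m' mZ D)%E.
  move=> mD.
  have U := @product_measure_unique _ _ _ _ R N (normal_prob (0 : R) 1) (m' mZ).
  rewrite -U//; last first.
    move=> C C' mC mC'.
    rewrite [LHS](_ : _ = P [set w | forall i, B0 C C' i (X w ord0 i)]); last first.
      rewrite /m' /= /pushforward /mrestr; congr (P _); apply/seteqP; split => w /=.
        move=> [[h1 h2] h3] i; have := h3 i; rewrite /B0.
        by case: eqP => [->|_]//; case: eqP => [->|_].
      move=> h; split; first split.
      - by have := h p; rewrite /B0 eqxx.
      - by have := h q; rewrite /B0 [q == p]eq_sym (negbTE pq) eqxx.
      - by move=> i; have := h i; rewrite /B0; case: eqP => // _; case: eqP.
    rewrite PB0// muleA muleC muleA; congr (_ * _ * _)%E.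
    exact: rest_fin.
  apply/esym; rewrite [LHS](@ge0_integral_mscale _ _ R (normal_prob (0 : R) 1) setT
    measurableT (NngNum r0) (normal_prob (0 : R) 1 \o xsection D))//.
  exact: measurable_fun_xsection.
pose D : set (R * R) := [set z | A p (c * z.1 + s * z.2) /\ A q (s * z.1 - c * z.2)].
have mD : measurable D.
  have mlin : measurable_fun [set: R * R]
      (fun z => (c * z.1 + s * z.2, s * z.1 - c * z.2)).
    apply/measurable_fun_pairP; split => /=.
    - by apply: measurable_funD; apply: measurable_funM.
    - by apply: measurable_funB; apply: measurable_funM.
  have -> : D = setT `&`
      (fun z => (c * z.1 + s * z.2, s * z.1 - c * z.2)) @^-1` (A p `*` A q).
    by rewrite setTI.
  by apply: mlin => //; exact: measurableX.
transitivity (m' mZ D).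
  rewrite /m' /= /pushforward /mrestr; congr (P _); apply/seteqP; split => w /=.
    move=> h; split; first split.
    - by have := h p; rewrite mxE eqxx.
    - by have := h q; rewrite mxE [q == p]eq_sym (negbTE pq) eqxx.
    - move=> i; have := h i; rewrite mxE /B0; case: eqP => // _.
      by case: eqP.
  move=> [[h1 h2] h3] i; have := h3 i; rewrite mxE /B0.
  by case: eqP => [->|_]//; case: eqP => [->|_].
rewrite -m'E// normal_prob_reflection// split_prod -/rest -rest_fin.
by rewrite muleC muleA.
Qed.

(** The planar reflections act on disjoint pairs of coordinates, so they can be
performed one after the other. *)
Lemma gaussian_law_reflection (R : realType) d (T : measurableType d)
    (P : probability T R) n (X Y : T -> 'rV[R]_n) (c s : R) :
  0 < s -> c ^+ 2 + s ^+ 2 = 1 ->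
  gaussian_law P (fun w => row_mx (X w) (Y w)) ->
  gaussian_law P (fun w => row_mx (c *: X w + s *: Y w) (s *: X w - c *: Y w)).
Proof.
move=> s0 cs gXY.
pose refl (k : nat) w := row_mx
  (\row_(i < n) (if (i < k)%N then c * X w ord0 i + s * Y w ord0 i else X w ord0 i))
  (\row_(i < n) (if (i < k)%N then s * X w ord0 i - c * Y w ord0 i else Y w ord0 i)).
(* After [k] steps the first [k] pairs of coordinates have been reflected. *)
suff /(_ n (leqnn n)) : forall k, (k <= n)%N -> gaussian_law P (refl k).
  congr (gaussian_law P _); apply/funext => w; rewrite /refl; congr row_mx.
  - by apply/rowP => i; rewrite !mxE ltn_ord.
  - by apply/rowP => i; rewrite !mxE ltn_ord.
elim => [_|k IH kn].
  move: gXY; congr (gaussian_law P _); apply/funext => w; congr row_mx.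
  - by apply/rowP => i; rewrite !mxE.
  - by apply/rowP => i; rewrite !mxE.
pose i0 := Ordinal kn.
have pq : lshift n i0 != rshift n i0 by rewrite eq_lrshift.
have := gaussian_law_reflect2 pq s0 cs (IH (ltnW kn)).
congr (gaussian_law P _); apply/funext => w; apply/rowP => j.
rewrite mxE !row_mxEl !row_mxEr !mxE ltnn.
have ltk (i : 'I_n) : (i < k.+1)%N = (i == i0) || (i < k)%N.
  by rewrite ltnS leq_eqVlt -(inj_eq val_inj).
case: (split_ordP j) => i ->; rewrite ?row_mxEl ?row_mxEr !mxE ltk.
  by rewrite eq_lrshift eq_lshift; case: eqP => [->|].
by rewrite eq_rlshift eq_rshift; case: eqP => [->|].
Qed.

(** * Euclidean geometry and projections onto cones *)

Section DotProduct.
Variables (R : realType) (n : nat).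
Implicit Types (u v w x y : 'rV[R]_n) (a : R).

Lemma dotvC u v : dotv u v = dotv v u.
Proof. by apply: eq_bigr => i _; rewrite mulrC. Qed.

Lemma dotvDl u v w : dotv (u + v) w = dotv u w + dotv v w.
Proof. by rewrite -big_split; apply: eq_bigr => i _; rewrite mxE mulrDl. Qed.

Lemma dotvZl a u v : dotv (a *: u) v = a * dotv u v.
Proof. by rewrite mulr_sumr; apply: eq_bigr => i _; rewrite mxE mulrA. Qed.

Lemma dotvNl u v : dotv (- u) v = - dotv u v.
Proof. by rewrite -scaleN1r dotvZl mulN1r. Qed.

Lemma dotvBl u v w : dotv (u - v) w = dotv u w - dotv v w.
Proof. by rewrite dotvDl dotvNl. Qed.

Lemma dotvDr u v w : dotv w (u + v) = dotv w u + dotv w v.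
Proof. by rewrite dotvC dotvDl !(dotvC w). Qed.

Lemma dotvZr a u v : dotv v (a *: u) = a * dotv v u.
Proof. by rewrite dotvC dotvZl (dotvC v). Qed.

Lemma dotvNr u v : dotv v (- u) = - dotv v u.
Proof. by rewrite dotvC dotvNl (dotvC v). Qed.

Lemma dotvBr u v w : dotv w (u - v) = dotv w u - dotv w v.
Proof. by rewrite dotvDr dotvNr. Qed.

Lemma dotv0l u : dotv 0 u = 0.
Proof. by rewrite -(scale0r u) dotvZl mul0r. Qed.

Lemma dotv0r u : dotv u 0 = 0.
Proof. by rewrite dotvC dotv0l. Qed.

Definition dotvE := (dotvDl, dotvDr, dotvNl, dotvNr, dotvZl, dotvZr).

Lemma dotv_ge0 u : 0 <= dotv u u.
Proof. by apply: sumr_ge0 => i _; rewrite -expr2 sqr_ge0. Qed.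

Lemma sqr_coord_le_dotv u i : u ord0 i ^+ 2 <= dotv u u.
Proof.
by rewrite /dotv (bigD1 i)//= -expr2 lerDl sumr_ge0// => j _; rewrite -expr2 sqr_ge0.
Qed.

Lemma dotv_eq0 u : dotv u u = 0 -> u = 0.
Proof.
move=> u0; apply/rowP => i; rewrite mxE; apply/eqP; rewrite -sqrf_eq0.
by rewrite eq_le sqr_ge0 andbT -u0 sqr_coord_le_dotv.
Qed.

Lemma enorm_ge0 u : 0 <= enorm u.
Proof. exact: sqrtr_ge0. Qed.

Lemma sqr_enorm u : enorm u ^+ 2 = dotv u u.
Proof. by rewrite sqr_sqrtr// dotv_ge0. Qed.

Lemma enorm_eq0 u : enorm u = 0 -> u = 0.
Proof. by move=> u0; apply: dotv_eq0; rewrite -sqr_enorm u0 expr0n. Qed.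

Lemma dotv_le_enorm u v : dotv u v <= enorm u * enorm v.
Proof.
have [/enorm_eq0 ->|u0] := eqVneq (enorm u) 0.
  by rewrite dotv0l mulr_ge0// enorm_ge0.
have [/enorm_eq0 ->|v0] := eqVneq (enorm v) 0.
  by rewrite dotv0r mulr_ge0// enorm_ge0.
have up : 0 < enorm u by rewrite lt_def u0 enorm_ge0.
have vp : 0 < enorm v by rewrite lt_def v0 enorm_ge0.
have := dotv_ge0 (enorm v *: u - enorm u *: v).
rewrite !dotvE -!sqr_enorm (dotvC v u) => h.
rewrite -(ler_pM2l (mulr_gt0 up vp)); nra.
Qed.

Lemma enormZ a u : enorm (a *: u) = `|a| * enorm u.
Proof.
by rewrite /enorm dotvZl dotvZr mulrA -expr2 sqrtrM ?sqr_ge0// sqrtr_sqr.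
Qed.

Lemma enormD u v : enorm (u + v) <= enorm u + enorm v.
Proof.
have h0 : 0 <= enorm u + enorm v by rewrite addr_ge0// enorm_ge0.
rewrite -(ler_sqr (enorm_ge0 _) h0) sqr_enorm !dotvE sqrrD !sqr_enorm.
have := dotv_le_enorm u v; rewrite (dotvC v u); lra.
Qed.

Lemma continuous_coord_sum (F : 'I_n -> 'rV[R]_n -> R) :
  (forall i, continuous (F i)) -> continuous (fun x => \sum_i F i x).
Proof.
move=> cF; apply: (@continuous_big R _ +%R 0 predT) => [|i _]; last exact: cF.
by move=> z; apply: (@cvgD _ R^o); [exact: cvg_fst|exact: cvg_snd].
Qed.

Lemma dotv_continuous (f g : 'rV[R]_n -> 'rV[R]_n) :
  (forall i, continuous (fun x => f x ord0 i)) ->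
  (forall i, continuous (fun x => g x ord0 i)) ->
  continuous (fun x => dotv (f x) (g x)).
Proof.
move=> cf cg; apply: continuous_coord_sum => i x.
by apply: continuousM; [exact: (cf i x)|exact: (cg i x)].
Qed.

Lemma sqdist_continuous x : continuous (fun y => dotv (x - y) (x - y)).
Proof.
have h i : continuous (fun y => (x - y) ord0 i).
  have -> : (fun y => (x - y) ord0 i) = (fun y => x ord0 i - y ord0 i).
    by apply/funext => y; rewrite !mxE.
  move=> y; apply: (@continuousB R R^o _ (fun=> x ord0 i) (fun y : 'rV[R]_n => y ord0 i)).
    exact: cst_continuous.
  exact: coord_continuous.
exact: dotv_continuous.
Qed.

Lemma enormN u : enorm (- u) = enorm u.
Proof. by rewrite /enorm dotvNl dotvNr opprK. Qed.

End DotProduct.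

Section ConeProjection.
Variables (R : realType) (n : nat).
Implicit Types (K : set 'rV[R]_n) (x y z : 'rV[R]_n).

(** The points of the set that are no farther from [x] than a given one form a
compact set. *)
Lemma closed_projection_exists K x : K !=set0 -> closed K ->
  exists y, K y /\ forall z, K z -> enorm (x - y) <= enorm (x - z).
Proof.
move=> [z0 Kz0] cK.
have cn : continuous (fun y => dotv (x - y) (x - y)) by exact: sqdist_continuous.
pose r := dotv (x - z0) (x - z0).
pose A := K `&` [set y | dotv (x - y) (x - y) <= r].
have cA : closed A.
  apply: closedI => //.
  by apply: (@closed_comp _ _ (fun y => dotv (x - y) (x - y)) [set t | t <= r])
    => //; exact: closed_le.
have bA : bounded_set A.
  exists (`|x| + enorm (x - z0)); split; first exact: num_real.
  move=> M ltM y [_ /= hy]; apply: le_trans (ltW ltM).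
  rewrite -[y](subrK x) addrC (le_trans (ler_normD _ _))// lerD2l.
  rewrite /Num.norm /= mx_normrE; apply/bigmax_leP; split; first exact: enorm_ge0.
  move=> [i j] _ /=; rewrite ord1 -(ler_sqr (normr_ge0 _) (enorm_ge0 _)).
  rewrite -normrX ger0_norm ?sqr_ge0// sqr_enorm.
  rewrite (le_trans (sqr_coord_le_dotv _ _))// (le_trans _ hy)//.
  by rewrite -opprB dotvNl dotvNr opprK.
have [|c /set_mem[Kc hc] minc] := @EVT_min_rV R n (fun y => dotv (x - y) (x - y)) A _
   (bounded_closed_compact bA cA) (continuous_subspaceT cn).
  by exists z0; split => //=.
exists c; split=> // z Kz; rewrite /enorm ler_sqrt ?dotv_ge0//.
have [hz|hz] := leP (dotv (x - z) (x - z)) r; first by apply: minc; apply/mem_set.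
by rewrite (le_trans hc)// ltW.
Qed.

Lemma metric_projP K x : K !=set0 -> closed K ->
  K (metric_proj K x) /\
  forall z, K z -> enorm (x - metric_proj K x) <= enorm (x - z).
Proof.
move=> K0 cK; have [y hy] := closed_projection_exists x K0 cK.
exact: (@xgetI _ 0 [set y | K y /\ forall z, K z -> enorm (x - y) <= enorm (x - z)] y hy).
Qed.

Lemma cone_add K x y : closed_convex_cone K -> K x -> K y -> K (x + y).
Proof.
move=> [_ _ cvx cone] Kx Ky.
have [h0 h1] : 0 <= 2^-1 :> R /\ 2^-1 <= 1 :> R by split; lra.
pose h : {i01 R} := Itv01 h0 h1.
have Kh : K (2^-1 *: x + (1 - 2^-1) *: y).
  have := cvx x y h (mem_set Kx) (mem_set Ky).
  by rewrite inE.
have := cone 2 _ (ler0n _ _) Kh; congr (K _).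
rewrite scalerDr !scalerA mulfV ?pnatr_eq0// scale1r; congr (_ + _).
have -> : 2 * (1 - 2^-1) = 1 :> R by field.
by rewrite scale1r.
Qed.

(** First-order optimality of the projection along the rays [p + t z] and
[(1 +- t) p]. *)
Lemma cone_projP K x : closed_convex_cone K ->
  [/\ K (metric_proj K x), dotv (x - metric_proj K x) (metric_proj K x) = 0 &
      forall z, K z -> dotv (x - metric_proj K x) z <= 0].
Proof.
move=> hK; have [K0 cK _ cone] := hK.
have [Kp minp] := metric_projP x K0 cK; set p := metric_proj K x in Kp minp *.
have key z t : K (p + t *: z) -> 2 * t * dotv (x - p) z <= t ^+ 2 * dotv z z.
  move=> /minp; rewrite -(ler_sqr (enorm_ge0 _) (enorm_ge0 _)) !sqr_enorm.
  rewrite opprD addrA; move: (x - p) => q; rewrite !dotvE (dotvC z q); lra.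
have neg z : K z -> dotv (x - p) z <= 0.
  move=> Kz; have kt t : 0 < t -> 2 * dotv (x - p) z <= t * dotv z z.
    move=> t0; have := key z t (cone_add hK Kp (cone _ _ (ltW t0) Kz)).
    rewrite expr2 -mulrA [2 * _]mulrCA -mulrA ler_pM2l//.
  rewrite leNgt; apply/negP => pos.
  have zz : 0 <= dotv z z := dotv_ge0 z.
  (* A step so short that the quadratic term cannot absorb the linear one. *)
  have t0 : 0 < dotv (x - p) z / (dotv z z + 1) by rewrite divr_gt0// ltr_wpDl.
  have := kt _ t0; rewrite leNgt => /negP; apply.
  rewrite mulrAC ltr_pdivrMr ?ltr_wpDl//; nra.
split=> //; apply/eqP; rewrite eq_le neg//= leNgt; apply/negP => ng.
have kt t : 0 < t -> t <= 1 -> - (2 * dotv (x - p) p) <= t * dotv p p.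
  move=> t0 t1; have Kq : K (p + (- t) *: p).
    rewrite -[X in X + _]scale1r -scalerDl; apply: cone => //.
    by rewrite subr_ge0.
  have := key p (- t) Kq; rewrite sqrrN expr2 => h.
  rewrite -(ler_pM2l t0); lra.
have pp : 0 <= dotv p p := dotv_ge0 p.
pose t := Num.min 1 (- dotv (x - p) p / (dotv p p + 1)).
have t0 : 0 < t by rewrite lt_min ltr01/= divr_gt0 ?oppr_gt0// ltr_wpDl.
have t1 : t <= 1 by rewrite ge_min lexx.
have t2 : t <= - dotv (x - p) p / (dotv p p + 1) by rewrite ge_min lexx orbT.
have := kt t t0 t1.
move: t2; rewrite ler_pdivlMr ?ltr_wpDl//; nra.
Qed.

Section Fixed.
Variables (K : set 'rV[R]_n) (hK : closed_convex_cone K).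

Lemma metric_proj_in x : K (metric_proj K x).
Proof. by have [] := cone_projP x hK. Qed.

Lemma dotv_metric_proj x : dotv x (metric_proj K x) = enorm (metric_proj K x) ^+ 2.
Proof.
have [_ h _] := cone_projP x hK; rewrite sqr_enorm; apply/eqP.
by rewrite -subr_eq0 -dotvBl h.
Qed.

Lemma dotv_le_proj x z : K z -> dotv x z <= dotv (metric_proj K x) z.
Proof. by have [_ _ h] := cone_projP x hK => /h; rewrite dotvBl subr_le0. Qed.

(** Half the squared norm of the projection is the conjugate of half the squared
norm restricted to the cone; any element of the cone gives a lower bound. *)
Lemma sqr_enorm_proj_ge x z : K z ->
  2 * dotv x z - dotv z z <= enorm (metric_proj K x) ^+ 2.
Proof.
move=> Kz; rewrite sqr_enorm; have := dotv_le_proj x Kz.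
have := dotv_ge0 (metric_proj K x - z); rewrite !dotvE.
by rewrite (dotvC z); lra.
Qed.

Lemma enorm_projB x y :
  enorm (metric_proj K x - metric_proj K y) <= enorm (x - y).
Proof.
set p := metric_proj K x; set q := metric_proj K y.
have h1 := dotv_le_proj x (metric_proj_in y); rewrite -/p -/q in h1.
have h2 := dotv_le_proj y (metric_proj_in x); rewrite -/p -/q in h2.
have h3 := dotv_metric_proj x; rewrite -/p sqr_enorm in h3.
have h4 := dotv_metric_proj y; rewrite -/q sqr_enorm in h4.
have h5 : enorm (p - q) ^+ 2 <= dotv (x - y) (p - q).
  move: p q h1 h2 h3 h4 => p q h1 h2 h3 h4.
  rewrite sqr_enorm !dotvE h3 h4; move: h1 h2; rewrite (dotvC q p); lra.
have := le_trans h5 (dotv_le_enorm _ _); rewrite expr2.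
have := enorm_ge0 (p - q); rewrite le0r => /orP[/eqP -> _|pq].
  exact: enorm_ge0.
by rewrite ler_pM2r.
Qed.

(** The norm of the projection is the support function of the part of the cone
inside the unit ball, so the normalized projection, where the supremum is
attained, is a subgradient. *)
Lemma enorm_proj_subgradient x y :
  enorm (metric_proj K x) - enorm (metric_proj K y) <=
  dotv ((enorm (metric_proj K x))^-1 *: metric_proj K x) (x - y).
Proof.
set p := metric_proj K x; set q := metric_proj K y; set t := enorm p.
have [t0|t0] := eqVneq t 0.
  by rewrite t0 invr0 scale0r dotv0l sub0r oppr_le0 enorm_ge0.
have tp : 0 < t by rewrite lt_def t0 enorm_ge0.
rewrite dotvZl dotvBr mulrBr lerB//.
  by rewrite (dotvC p) dotv_metric_proj -/p -/t expr2 mulrA mulVf// mul1r.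
rewrite mulrC ler_pdivrMr// mulrC (dotvC p).
by rewrite (le_trans (dotv_le_proj y (metric_proj_in x)))// mulrC dotv_le_enorm.
Qed.

End Fixed.
End ConeProjection.

Section Subspace.
Variables (R : realType) (n : nat) (U : {vspace 'rV[R]_n}).
Let L : set 'rV[R]_n := [set x | x \in U].

Lemma linear_coord_continuous (f : {linear 'rV[R]_n -> 'rV[R]_n}) i :
  continuous (fun x : 'rV[R]_n => f x ord0 i).
Proof.
have -> : (fun x : 'rV[R]_n => f x ord0 i) =
    (fun x => dotv x (\row_j f (delta_mx 0 j) ord0 i)).
  apply/funext => x; rewrite [in LHS](row_sum_delta x) linear_sum summxE.
  by apply: eq_bigr => j _; rewrite linearZ !mxE.
by apply: dotv_continuous => j; [exact: coord_continuous|exact: cst_continuous].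
Qed.

Lemma subspace_closed_convex_cone : closed_convex_cone L.
Proof.
split.
- by exists 0; rewrite /L /= mem0v.
- have -> : L = [set x | dotv (x - projv U x) (x - projv U x) <= 0].
    apply/seteqP; split => x /=.
      by move=> xU; rewrite projv_id// subrr dotv0l.
    move=> h; have /dotv_eq0/eqP : dotv (x - projv U x) (x - projv U x) = 0.
      by apply/eqP; rewrite eq_le h dotv_ge0.
    by rewrite subr_eq0 => /eqP E; rewrite /L /= E memv_proj.
  have cc i : continuous (fun x : 'rV[R]_n => (x - projv U x) ord0 i).
    have -> : (fun x : 'rV[R]_n => (x - projv U x) ord0 i) =
        (fun x => x ord0 i - projv U x ord0 i).
      by apply/funext => y; rewrite !mxE.
    move=> y; apply: (@continuousB R R^o _ (fun x : 'rV[R]_n => x ord0 i)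
      (fun y : 'rV[R]_n => projv U y ord0 i)).
      exact: coord_continuous.
    exact: (@linear_coord_continuous (projv U) i y).
  apply: (@closed_comp _ _ (fun x : 'rV[R]_n => dotv (x - projv U x) (x - projv U x))
    [set t : R | t <= 0]).
    by move=> x _; exact: dotv_continuous.
  exact: closed_le.
- move=> x y t /set_mem xL /set_mem yL; apply/mem_set.
  by rewrite /L /=; apply: memvD; apply: memvZ.
- by move=> t x _ xU; rewrite /L /= memvZ.
Qed.

Lemma subspace_proj_orth x z : z \in U -> dotv (x - metric_proj L x) z = 0.
Proof.
move=> zU; have [_ _ h] := cone_projP x subspace_closed_convex_cone.
apply/eqP; rewrite eq_le h//=.
have := h (- z); rewrite dotvNr oppr_le0; apply.
by rewrite /L /= memvN.
Qed.

End Subspace.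

(** * Functions of quadratic growth and their Gaussian means *)

Section Growth.
Variables (R : realType) (n : nat).
Implicit Types (F G : 'rV[R]_n -> R) (u x y : 'rV[R]_n).

(** Lipschitz continuity for the Euclidean norm, as opposed to the max norm, which
is the canonical norm of row vectors. *)
Definition elipschitz F :=
  exists C, forall x y, F x - F y <= C * enorm (x - y).

Definition vlipschitz m (A : 'rV[R]_n -> 'rV[R]_m) :=
  exists C, 0 <= C /\ forall x y, enorm (A x - A y) <= C * enorm (x - y).

(** A class of functions with finite Gaussian mean that contains the squares and
the products of Lipschitz functions. *)
Definition quadratic_growth F :=
  continuous F /\ exists a b, forall x, `|F x| <= a + b * dotv x x.

Lemma elipschitz_norm F : elipschitz F ->
  exists C, 0 <= C /\ forall x y, `|F x - F y| <= C * enorm (x - y).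
Proof.
move=> [C lF]; exists `|C|; split=> // x y.
have h x' y' : F x' - F y' <= `|C| * enorm (x' - y').
  by apply: le_trans (lF _ _) _; rewrite ler_wpM2r ?enorm_ge0 ?ler_norm.
by rewrite ler_norml h andbT lerNl opprB -enormN opprB h.
Qed.

(** The topology of row vectors is that of the max norm; the squared Euclidean
distance to a point is continuous for it, being a polynomial in the coordinates. *)
Lemma elipschitz_continuous F : elipschitz F -> continuous F.
Proof.
move=> /elipschitz_norm[C [C0 lF]] x.
have FF : Filter (nbhs (x : 'rV[R]_n)) by exact: nbhs_filter.
have cn : continuous (fun y => dotv (x - y) (x - y)) by exact: sqdist_continuous.
apply/(@cvgrPdist_lt _ R^o _ (nbhs (x : 'rV[R]_n)) FF) => e e0.
have d0 : 0 < e / (C + 1) by rewrite divr_gt0// ltr_wpDl.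
have d20 : 0 < (e / (C + 1)) ^+ 2 by rewrite exprn_gt0.
have /(@cvgrPdist_lt _ R^o _ (nbhs (x : 'rV[R]_n)) FF)/(_ _ d20) :=
  (cn x : (fun y => dotv (x - y) (x - y)) y @[y --> x] --> dotv (x - x) (x - x)).
apply: (@filterS _ (nbhs x) (nbhs_filter x)) => y /=.
rewrite subrr dotv0l sub0r normrN => h.
have {}h : enorm (x - y) < e / (C + 1).
  rewrite -(ltr_sqr (enorm_ge0 _)) ?nnegrE ?ltW// sqr_enorm.
  exact: le_lt_trans (ler_norm _) h.
apply: le_lt_trans (lF x y) _; move: h; rewrite ltr_pdivlMr ?ltr_wpDl//.
have := enorm_ge0 (x - y); nra.
Qed.

Lemma elipschitzB F G : elipschitz F -> elipschitz G -> elipschitz (fun x => F x - G x).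
Proof.
move=> /elipschitz_norm[C [_ lF]] /elipschitz_norm[D [_ lG]]; exists (C + D) => x y.
have := lF x y; have := lG x y; rewrite !ler_norml mulrDl.
by move=> /andP[? ?] /andP[? ?]; lra.
Qed.

Lemma elipschitz_max0 F : elipschitz F -> elipschitz (fun x => Num.max 0 (F x)).
Proof.
move=> /elipschitz_norm[C [C0 lF]]; exists C => x y.
have := lF x y; rewrite ler_norml => /andP[h1 h2].
have h3 : 0 <= C * enorm (x - y) by rewrite mulr_ge0// enorm_ge0.
by case: (leP 0 (F x)) => ?; case: (leP 0 (F y)) => ?; lra.
Qed.

Lemma elipschitz_dotv u : elipschitz (dotv u).
Proof. by exists (enorm u) => x y; rewrite -dotvBr dotv_le_enorm. Qed.

Lemma elipschitz_enorm : elipschitz (@enorm R n).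
Proof.
exists 1 => x y; rewrite mul1r lerBlDr -[in leLHS](subrK y x).
exact: enormD.
Qed.

Lemma elipschitz_sqr_growth F : elipschitz F -> quadratic_growth (fun x => F x ^+ 2).
Proof.
move=> lF; split.
  have cF := elipschitz_continuous lF.
  by move=> x; apply: (@continuousM _ _ F F x); exact: cF.
have [C [C0 h]] := elipschitz_norm lF.
exists (2 * F 0 ^+ 2), (2 * C ^+ 2) => x.
rewrite ger0_norm ?sqr_ge0// -sqr_enorm.
have := h x 0; rewrite subr0 ler_norml => /andP[h1 h2].
have e0 := enorm_ge0 x.
have : (F x - F 0) ^+ 2 <= (C * enorm x) ^+ 2.
  rewrite -subr_ge0 subr_sqr mulr_ge0//; lra.
by rewrite exprMn; have := sqr_ge0 (F 0 - (F x - F 0)); nra.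
Qed.

Lemma continuous_scaled_add c F G : continuous F -> continuous G ->
  continuous (fun x => c * F x + G x).
Proof.
move=> cF cG x; apply: (@continuousD R R^o _ (fun x => c * F x) G).
  by apply: (@continuousM _ _ (fun=> c) F); [exact: cst_continuous|exact: cF].
exact: cG.
Qed.

Lemma growth_scaled_add c F G : quadratic_growth F -> quadratic_growth G ->
  quadratic_growth (fun x => c * F x + G x).
Proof.
move=> [cF [a [b hF]]] [cG [a' [b' hG]]]; split; first exact: continuous_scaled_add.
exists (`|c| * a + a'), (`|c| * b + b') => x.
rewrite (le_trans (ler_normD _ _))// normrM.
have := ler_wpM2l (normr_ge0 c) (hF x); have := hG x; lra.
Qed.

Lemma growth_cst c : quadratic_growth (fun=> c).
Proof.
split; first exact: cst_continuous.
by exists `|c|, 0 => x; rewrite mul0r addr0.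
Qed.

Lemma growthZ c F : quadratic_growth F -> quadratic_growth (fun x => c * F x).
Proof.
move=> hF; have := growth_scaled_add c hF (growth_cst 0).
by congr quadratic_growth; apply/funext => x; rewrite addr0.
Qed.

Lemma growthD F G : quadratic_growth F -> quadratic_growth G ->
  quadratic_growth (fun x => F x + G x).
Proof.
move=> hF hG; have := growth_scaled_add 1 hF hG.
by congr quadratic_growth; apply/funext => x; rewrite mul1r.
Qed.

Lemma growthB F G : quadratic_growth F -> quadratic_growth G ->
  quadratic_growth (fun x => F x - G x).
Proof.
move=> hF hG; have := growth_scaled_add (- 1) hG hF.
by congr quadratic_growth; apply/funext => x; rewrite mulN1r addrC.
Qed.

Lemma growthM F G : elipschitz F -> elipschitz G -> quadratic_growth (fun x => F x * G x).
Proof.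
move=> lF lG.
have cFG : continuous (fun x => F x * G x).
  move=> x; apply: (@continuousM _ _ F G x); first exact: elipschitz_continuous.
  exact: elipschitz_continuous.
split=> //.
have [_ [a [b h]]] := elipschitz_sqr_growth lF.
have [_ [a' [b' h']]] := elipschitz_sqr_growth lG.
exists (a + a'), (b + b') => x.
have := h x; rewrite (ger0_norm (sqr_ge0 _)) => h1.
have := h' x; rewrite (ger0_norm (sqr_ge0 _)) => h2.
rewrite ler_norml; apply/andP; split.
  have := sqr_ge0 (F x + G x); nra.
have := sqr_ge0 (F x - G x); nra.
Qed.

Lemma elipschitz_cst c : elipschitz (fun=> c).
Proof. by exists 0 => x y; rewrite subrr mul0r. Qed.

Lemma elipschitz_growth F : elipschitz F -> quadratic_growth F.
Proof.
move=> lF; have := growthM lF (elipschitz_cst 1).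
by congr quadratic_growth; apply/funext => x; rewrite mulr1.
Qed.

Lemma elipschitz_coord i : elipschitz (fun x => x ord0 i).
Proof.
exists 1 => x y; rewrite mul1r; have := sqr_coord_le_dotv (x - y) i.
rewrite -sqr_enorm !mxE; have := enorm_ge0 (x - y); nra.
Qed.

Lemma growth_sum (I : Type) (r : seq I) (F : I -> 'rV[R]_n -> R) :
  (forall i, quadratic_growth (F i)) -> quadratic_growth (fun x => \sum_(i <- r) F i x).
Proof.
move=> hF; elim: r => [|i r IH].
  by under eq_fun do rewrite big_nil; exact: growth_cst.
by under eq_fun do rewrite big_cons; exact: growthD.
Qed.

End Growth.

Lemma elipschitz_comp (R : realType) m n (F : 'rV[R]_m -> R)
    (A : 'rV[R]_n -> 'rV[R]_m) :
  elipschitz F -> vlipschitz A -> elipschitz (fun x => F (A x)).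
Proof.
move=> /elipschitz_norm[C [C0 hF]] [D [D0 hA]]; exists (C * D) => x y.
rewrite (le_trans (ler_norm _))// (le_trans (hF _ _))// -mulrA ler_wpM2l//.
Qed.

Lemma vlipschitz_submx (R : realType) n (c s : R) :
  vlipschitz (fun z : 'rV[R]_(n + n) => c *: lsubmx z + s *: rsubmx z).
Proof.
exists (`|c| + `|s|); split=> [|x y]; first by rewrite addr_ge0.
rewrite opprD addrACA -!scalerBr -!linearB /=; move: (x - y) => z.
have [hl hr] : enorm (lsubmx z) <= enorm z /\ enorm (rsubmx z) <= enorm z.
  have dz : dotv z z = dotv (lsubmx z) (lsubmx z) + dotv (rsubmx z) (rsubmx z).
    rewrite /dotv big_split_ord; congr (_ + _).
    - by apply: eq_bigr => i _; rewrite mxE.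
    - by apply: eq_bigr => i _; rewrite mxE.
  rewrite -!(ler_sqr (enorm_ge0 _) (enorm_ge0 _)) !sqr_enorm dz.
  by rewrite lerDl lerDr !dotv_ge0.
rewrite (le_trans (enormD _ _))// !enormZ mulrDl lerD// ler_wpM2l//.
Qed.

(** Kept as a symbol between [1 / 3] and [16 / 3], so that it enters the estimates
below as an absolute constant. *)
Definition normal_second_moment (R : realType) : R :=
  fine (\int[normal_prob (0 : R) 1]_x (x ^+ 2)%:E)%E.

Lemma normal_second_moment_ge (R : realType) : 1 / 3 <= normal_second_moment R.
Proof.
rewrite /normal_second_moment; have := normal_second_moment_bounds R.
by case: (\int[_]_x _)%E => [r| |] //= /andP[]//; rewrite !lee_fin.
Qed.

Lemma normal_second_moment_le (R : realType) : normal_second_moment R <= 16 / 3.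
Proof.
rewrite /normal_second_moment; have := normal_second_moment_bounds R.
by case: (\int[_]_x _)%E => [r| |] //= /andP[]//; rewrite !lee_fin.
Qed.

Definition gmean (R : realType) d (T : measurableType d) (P : probability T R)
  n (X : T -> 'rV[R]_n) (F : 'rV[R]_n -> R) : R := \int[P]_w F (X w).

Section GaussianMean.
Variables (R : realType) (d : measure_display) (T : measurableType d)
  (P : probability T R) (n : nat) (X : T -> 'rV[R]_n).
Hypothesis gX : gaussian_law P X.
Implicit Types (F G : 'rV[R]_n -> R) (u : 'rV[R]_n).

Lemma measurable_gaussian_fun F : continuous F -> measurable_fun [set: T] (F \o X).
Proof.
move=> cF; apply: (measurableT_comp (continuous_box_measurable cF)).
exact: gaussian_law_measurable gX.1.
Qed.

Lemma integral_coord_sqr i :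
  (\int[P]_w (X w ord0 i ^+ 2)%:E = (normal_second_moment R)%:E)%E.
Proof.
have mX := gX.1 i.
have m2 : measurable_fun [set: R] (fun x : R => (x ^+ 2)%:E).
  by apply/measurable_EFinP; exact: exprn_measurable.
have fin2 : (\int[normal_prob (0 : R) 1]_x (x ^+ 2)%:E)%E \is a fin_num.
  have := normal_second_moment_bounds R.
  by case: (\int[_]_x _)%E => [r| |] //= /andP[].
rewrite /normal_second_moment fineK//.
transitivity (\int[pushforward P (fun w => X w ord0 i : measurableTypeR R)]_x
    (x ^+ 2)%:E)%E.
  by rewrite ge0_integral_pushforward// => x _; rewrite lee_fin sqr_ge0.
apply: eq_measure_integral => // A mA _.
rewrite /pushforward.
have mB j : measurable (if j == i then A else setT) by case: ifP.
transitivity (P [set w | forall j, (if j == i then A else setT) (X w ord0 j)]).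
  congr (P _); apply/seteqP; split => w /= h; last by have := h i; rewrite eqxx.
  by move=> j; case: eqP => [->|].
etransitivity; first exact: (gX.2 (fun j => if j == i then A else setT) mB).
rewrite (bigD1 i)//= eqxx big1 ?mule1// => j /negbTE ->.
exact: probability_setT.
Qed.

Lemma gmean_integrable F : quadratic_growth F ->
  P.-integrable [set: T] (EFin \o (F \o X)).
Proof.
move=> [cF [a [b hF]]].
have mF := measurable_gaussian_fun cF.
have isq i : P.-integrable [set: T] (fun w => (X w ord0 i ^+ 2)%:E).
  apply/integrableP; split.
    by apply/measurable_EFinP; apply: measurable_funX; exact: gX.1.
  under eq_integral do rewrite /= ger0_norm ?sqr_ge0//.
  by rewrite integral_coord_sqr ltry.
apply: (@le_integrable _ _ _ P setT measurableT _
  (fun w => a%:E + b%:E * \sum_(i < n) (X w ord0 i ^+ 2)%:E)%E).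
- exact/measurable_EFinP.
- move=> w _ /=; rewrite sumEFin -EFinM -EFinD lee_fin (le_trans (hF _))//.
  by rewrite (le_trans _ (ler_norm _)).
- apply: integrableD => //; first exact: finite_measure_integrable_cst.
  by apply: integrableZl => //; exact: integrable_sum.
Qed.

Lemma EFin_gmean F : quadratic_growth F ->
  (\int[P]_w (F (X w))%:E = (gmean P X F)%:E)%E.
Proof. by move=> hF; rewrite fineK// integrable_fin_num//; exact: gmean_integrable. Qed.

Lemma gmeanD F G : quadratic_growth F -> quadratic_growth G ->
  gmean P X (fun x => F x + G x) = gmean P X F + gmean P X G.
Proof. by move=> hF hG; apply: RintegralD => //; exact: gmean_integrable. Qed.

Lemma gmeanB F G : quadratic_growth F -> quadratic_growth G ->
  gmean P X (fun x => F x - G x) = gmean P X F - gmean P X G.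
Proof. by move=> hF hG; apply: RintegralB => //; exact: gmean_integrable. Qed.

Lemma gmeanZ c F : quadratic_growth F ->
  gmean P X (fun x => c * F x) = c * gmean P X F.
Proof. by move=> hF; apply: RintegralZl => //; exact: gmean_integrable. Qed.

Lemma gmean_cst c : gmean P X (fun=> c) = c.
Proof.
rewrite /gmean [LHS](@Rintegral_cst _ _ _ P _ measurableT).
by rewrite [X in fine X](@probability_setT _ _ _ P) /= mulr1.
Qed.

Lemma gmean_le F G : quadratic_growth F -> quadratic_growth G ->
  (forall x, F x <= G x) -> gmean P X F <= gmean P X G.
Proof. by move=> hF hG FG; apply: le_Rintegral => //; exact: gmean_integrable. Qed.

Lemma gmean_sum (I : Type) (r : seq I) (F : I -> 'rV[R]_n -> R) :
  (forall i, quadratic_growth (F i)) ->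
  gmean P X (fun x => \sum_(i <- r) F i x) = \sum_(i <- r) gmean P X (F i).
Proof.
move=> hF; elim: r => [|i r IH].
  by rewrite big_nil -[RHS](gmean_cst 0); congr gmean; apply/funext => x; rewrite big_nil.
rewrite big_cons -IH -gmeanD//; last exact: growth_sum.
by congr gmean; apply/funext => x; rewrite big_cons.
Qed.

End GaussianMean.

Lemma growth_dotv (R : realType) n : quadratic_growth (fun x : 'rV[R]_n => dotv x x).
Proof.
have := elipschitz_sqr_growth (@elipschitz_enorm R n).
by congr quadratic_growth; apply/funext => x; rewrite sqr_enorm.
Qed.

Lemma gmean_law (R : realType) d (T : measurableType d)
    (P : probability T R) d' (T' : measurableType d') (P' : probability T' R)
    n (X : T -> 'rV[R]_n) (X' : T' -> 'rV[R]_n) (F : 'rV[R]_n -> R) :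
  gaussian_law P X -> gaussian_law P' X' -> quadratic_growth F ->
  gmean P X F = gmean P' X' F.
Proof.
move=> gX gX' hF; have [cF [a [b bF]]] := hF.
(* Adding the majorant [G] reduces the claim to nonnegative functions. *)
pose G (x : 'rV[R]_n) := a + b * dotv x x.
have hG : quadratic_growth G.
  by apply: growthD; [exact: growth_cst|apply: growthZ; exact: growth_dotv].
have hFG : quadratic_growth (fun x => F x + G x) by exact: growthD.
have G0 x : 0 <= G x by rewrite (le_trans _ (bF x)).
have FG0 x : 0 <= F x + G x.
  by have := bF x; rewrite ler_norml -/(G x) => /andP[+ _]; lra.
suff h : gmean P X (fun x => F x + G x) = gmean P' X' (fun x => F x + G x) /\
    gmean P X G = gmean P' X' G.
  move: h; rewrite (gmeanD gX hF hG) (gmeanD gX' hF hG) => -[h1 h2].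
  rewrite h2 in h1; exact: addIr h1.
split; congr fine.
  exact: (gaussian_law_integral gX gX' hFG.1 FG0).
exact: (gaussian_law_integral gX gX' hG.1 G0).
Qed.

(** * Second moments and the variance of a Lipschitz function *)

Section Moments.
Variables (R : realType) (d : measure_display) (T : measurableType d)
  (P : probability T R) (n : nat) (X : T -> 'rV[R]_n).
Hypothesis gX : gaussian_law P X.
Implicit Types (F : 'rV[R]_n -> R) (u : 'rV[R]_n).

Definition flip (e : pred 'I_n) (x : 'rV[R]_n) : 'rV[R]_n :=
  \row_i (if e i then - x ord0 i else x ord0 i).

Lemma gmean_flip (e : pred 'I_n) F : quadratic_growth F ->
  gmean P X F = gmean P (fun w => flip e (X w)) F.
Proof. by move=> hF; apply: gmean_law => //; exact: gaussian_law_signs. Qed.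

(** Flipping the signs of some coordinates preserves the law, so the mean is its
own opposite. *)
Lemma gmean_odd (e : pred 'I_n) F : quadratic_growth F ->
  (forall x, F (flip e x) = - F x) -> gmean P X F = 0.
Proof.
move=> hF oF; have E : gmean P X F = - gmean P X F.
  rewrite [LHS](gmean_flip e hF) -mulN1r -(gmeanZ gX)//.
  by apply: eq_Rintegral => w _; rewrite mulN1r oF.
by lra.
Qed.

Lemma gmean_dotv u : gmean P X (dotv u) = 0.
Proof.
apply: (@gmean_odd predT); first exact: elipschitz_growth (elipschitz_dotv u).
move=> x; have -> : flip predT x = - x by apply/rowP => i; rewrite !mxE.
exact: dotvNr.
Qed.

Lemma gmean_coordM i j :
  gmean P X (fun x => x ord0 i * x ord0 j) = (i == j)%:R * normal_second_moment R.
Proof.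
have [->|ij] := eqVneq i j.
  rewrite mul1r -[RHS]/(fine (normal_second_moment R)%:E) -(integral_coord_sqr gX j).
  by congr fine; apply: eq_integral => w _; rewrite expr2.
rewrite mul0r; apply: (@gmean_odd (pred1 i)).
  by apply: growthM; exact: elipschitz_coord.
by move=> x; rewrite !mxE /= eqxx eq_sym (negbTE ij) mulNr.
Qed.

Lemma gmean_dotv_sqr u :
  gmean P X (fun x => dotv u x ^+ 2) = normal_second_moment R * dotv u u.
Proof.
have -> : (fun x => dotv u x ^+ 2) =
    (fun x => \sum_i \sum_j (u ord0 i * u ord0 j) * (x ord0 i * x ord0 j)).
  apply/funext => x; rewrite expr2 /dotv mulr_suml; apply: eq_bigr => i _.
  by rewrite mulr_sumr; apply: eq_bigr => j _; rewrite mulrACA.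
have hc i j : quadratic_growth (fun x : 'rV[R]_n => x ord0 i * x ord0 j).
  by apply: growthM; exact: elipschitz_coord.
have hcc i j : quadratic_growth
    (fun x : 'rV[R]_n => u ord0 i * u ord0 j * (x ord0 i * x ord0 j)).
  exact: growthZ.
rewrite (gmean_sum gX) => [|i]; last exact: growth_sum.
rewrite /dotv mulr_sumr; apply: eq_bigr => i _.
rewrite (gmean_sum gX)// (bigD1 i)//= big1 => [|j ji].
  by rewrite (gmeanZ gX)// gmean_coordM eqxx mul1r addr0 mulrC.
by rewrite (gmeanZ gX)// gmean_coordM eq_sym (negbTE ji) mul0r mulr0.
Qed.

Lemma gmean_dotv_self : gmean P X (fun x => dotv x x) = n%:R * normal_second_moment R.
Proof.
rewrite /dotv (gmean_sum gX) => [|i]; last by apply: growthM; exact: elipschitz_coord.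
under eq_bigr do rewrite gmean_coordM eqxx mul1r.
by rewrite sumr_const card_ord mulr_natl.
Qed.

End Moments.

(** The argument concatenates two vectors, so that a pair of independent Gaussian
vectors becomes a single one, to which reflections apply. With [c, s] and
[c', s'] the cosines and sines of two angles, both points lie on the circle
through the two vectors. *)
Definition increment (R : realType) n (f : 'rV[R]_n -> R) (c s c' s' : R)
    (z : 'rV[R]_(n + n)) : R :=
  f (c *: lsubmx z + s *: rsubmx z) - f (c' *: lsubmx z + s' *: rsubmx z).

Lemma elipschitz_increment (R : realType) n (f : 'rV[R]_n -> R) (c s c' s' : R) :
  elipschitz f -> elipschitz (increment f c s c' s').
Proof.
by move=> lf; apply: elipschitzB; apply: elipschitz_comp => //; exact: vlipschitz_submx.
Qed.

Section Concentration.
Variables (R : realType) (d : measure_display) (T : measurableType d)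
  (P : probability T R) (n : nat) (X : T -> 'rV[R]_n).
Hypothesis gX : gaussian_law P X.
(* [u] selects a subgradient of norm at most 1 of the convex function [f]. *)
Variables (f : 'rV[R]_n -> R) (u : 'rV[R]_n -> 'rV[R]_n).
Hypothesis fu : forall x y, f x - f y <= dotv (u x) (x - y).
Hypothesis u1 : forall x, dotv (u x) (u x) <= 1.

Let Z (w : T * T) := row_mx (X w.1) (X w.2).
Let gZ : gaussian_law (P \x P)%E Z.
Proof. exact: gaussian_law_pair. Qed.
Let sigma2 := normal_second_moment R.

Let lf : elipschitz f.
Proof.
exists 1 => x y; rewrite mul1r (le_trans (fu x y))// (le_trans (dotv_le_enorm _ _))//.
by rewrite ler_piMl ?enorm_ge0// -(ler_sqr (enorm_ge0 _) ler01) expr1n sqr_enorm.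
Qed.

Lemma gmean_reflection (c s : R) (F : 'rV[R]_(n + n) -> R) :
  0 < s -> c ^+ 2 + s ^+ 2 = 1 -> quadratic_growth F ->
  gmean (P \x P)%E Z F =
  gmean (P \x P)%E (fun w => row_mx (c *: X w.1 + s *: X w.2) (s *: X w.1 - c *: X w.2)) F.
Proof. by move=> s0 cs hF; apply: gmean_law => //; exact: gaussian_law_reflection. Qed.

(* Mean square increment along the arc from the first copy to the point of the
circle with cosine [c] and sine [s]. *)
Let V (c s : R) := gmean (P \x P)%E Z (fun z => increment f 1 0 c s z ^+ 2).

(** The reflection across the middle point of the arc exchanges its two halves;
the square of the sum of the increments over them is at most twice the sum of
their squares. *)
Lemma increment_doubling (c s : R) : 0 < c -> 0 < s -> c ^+ 2 + s ^+ 2 = 1 ->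
  V (c ^+ 2 - s ^+ 2) (2 * c * s) <= 4 * V c s.
Proof.
move=> c0 s0 cs.
pose c2 := c ^+ 2 - s ^+ 2; pose s2 := 2 * c * s.
have s20 : 0 < s2 by rewrite /s2 !mulr_gt0.
have cs2 : c2 ^+ 2 + s2 ^+ 2 = 1.
  have -> : c2 ^+ 2 + s2 ^+ 2 = (c ^+ 2 + s ^+ 2) ^+ 2 by rewrite /c2 /s2; ring.
  by rewrite cs expr1n.
pose F1 z := increment f 1 0 c s z ^+ 2.
pose F2 z := increment f c s c2 s2 z ^+ 2.
have h1 : quadratic_growth F1 by apply: elipschitz_sqr_growth; exact: elipschitz_increment.
have h2 : quadratic_growth F2 by apply: elipschitz_sqr_growth; exact: elipschitz_increment.
have F21 : gmean (P \x P)%E Z F2 = V c s.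
  rewrite /V (gmean_reflection s20 cs2 h1); apply: eq_Rintegral => w _.
  rewrite /F1 /F2 /Z /increment !row_mxKl !row_mxKr scale1r scale0r addr0 -sqrrN opprB.
  congr ((f _ - f _) ^+ 2).
  rewrite !scalerDr !scalerN !scalerA addrACA -scalerDl -scalerBl.
  congr (_ *: _ + _ *: _).
  - have -> : c * c2 + s * s2 = (c ^+ 2 + s ^+ 2) * c by rewrite /c2 /s2; ring.
    by rewrite cs mul1r.
  - have -> : c * s2 - s * c2 = (c ^+ 2 + s ^+ 2) * s by rewrite /c2 /s2; ring.
    by rewrite cs mul1r.
have -> : 4 * V c s = 2 * gmean (P \x P)%E Z F1 + 2 * gmean (P \x P)%E Z F2.
  by rewrite F21 /V; ring.
rewrite -!(gmeanZ gZ)// -(gmeanD gZ); [|exact: growthZ|exact: growthZ].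
apply: (gmean_le gZ).
- by apply: elipschitz_sqr_growth; exact: elipschitz_increment.
- by apply: growthD; exact: growthZ.
move=> z; rewrite /F1 /F2 /increment -/c2 -/s2.
set p := f _; set q := f (c *: _ + _); set r := f (c2 *: _ + _).
by have := sqr_ge0 ((p - q) - (q - r)); lra.
Qed.

(** The increment is at most [(1 - c) <u x, x> - s <u x, y>] by convexity. As
[u x] has norm at most 1 and is independent of [y], the second inner product
has a mean square free of the dimension; the dimension enters only through the
first one, with the factor [(1 - c) ^+ 2] of fourth order in the angle. *)
Lemma increment_positive_part (c s : R) :
  gmean (P \x P)%E Z (fun z => Num.max 0 (increment f 1 0 c s z) ^+ 2) <=
  2 * (1 - c) ^+ 2 * (n%:R * sigma2) + 2 * s ^+ 2 * sigma2.
Proof.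
set F := (fun z => _).
have hF : quadratic_growth F.
  by apply: elipschitz_sqr_growth; apply: elipschitz_max0; exact: elipschitz_increment.
have F0 z : 0 <= F z by rewrite sqr_ge0.
have ptw (x y : 'rV[R]_n) : F (row_mx x y) <=
    2 * (1 - c) ^+ 2 * dotv x x + 2 * s ^+ 2 * dotv (u x) y ^+ 2.
  rewrite /F /increment row_mxKl row_mxKr scale1r scale0r addr0.
  have h := fu x (c *: x + s *: y).
  have E : dotv (u x) (x - (c *: x + s *: y)) = (1 - c) * dotv (u x) x - s * dotv (u x) y.
    by rewrite opprD !dotvE; ring.
  rewrite E in h.
  have cs : dotv (u x) x ^+ 2 <= dotv x x.
    have ux : enorm (u x) <= 1.
      by rewrite -(ler_sqr (enorm_ge0 _) ler01) expr1n sqr_enorm.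
    have := dotv_le_enorm (u x) x; have := dotv_le_enorm (u x) (- x).
    rewrite dotvNr enormN -sqr_enorm => h1 h2.
    have h3 : enorm (u x) * enorm x <= enorm x by rewrite ler_piMl ?enorm_ge0.
    have := enorm_ge0 x; nra.
  set D := f x - _ in h *.
  have m : Num.max 0 D ^+ 2 <= ((1 - c) * dotv (u x) x - s * dotv (u x) y) ^+ 2.
    case: (leP 0 D) => D0; last by rewrite expr0n sqr_ge0.
    by rewrite ler_sqr ?nnegrE// (le_trans D0).
  apply: le_trans m _.
  have h4 : (1 - c) ^+ 2 * dotv (u x) x ^+ 2 <= (1 - c) ^+ 2 * dotv x x.
    by rewrite ler_wpM2l ?sqr_ge0.
  have := sqr_ge0 ((1 - c) * dotv (u x) x + s * dotv (u x) y); nra.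
rewrite -lee_fin -(EFin_gmean gZ hF) (fubini_tonelli1 (m1 := P) (m2 := P))/=; last 2 first.
- by apply/measurable_EFinP; exact: (measurable_gaussian_fun gZ hF.1).
- by move=> w; rewrite lee_fin.
pose G (x : 'rV[R]_n) := 2 * (1 - c) ^+ 2 * dotv x x + 2 * s ^+ 2 * sigma2.
have hG : quadratic_growth G.
  by apply: growthD; [apply: growthZ; exact: growth_dotv|exact: growth_cst].
have EG : gmean P X G = 2 * (1 - c) ^+ 2 * (n%:R * sigma2) + 2 * s ^+ 2 * sigma2.
  rewrite (gmeanD gX); [|by apply: growthZ; exact: growth_dotv|exact: growth_cst].
  rewrite (gmeanZ gX _ (growth_dotv R n)).
  by rewrite gmean_cst (gmean_dotv_self gX).
rewrite -EG -(EFin_gmean gX hG); apply: ge0_le_integral => //.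
- by move=> w _; apply: integral_ge0 => w' _; rewrite lee_fin.
- apply: (measurable_fun_fubini_tonelli_F (m2 := P)) => /=.
  + by apply/measurable_EFinP; exact: (measurable_gaussian_fun gZ hF.1).
  + by move=> w; rewrite lee_fin.
- by apply/measurable_EFinP; exact: (measurable_gaussian_fun gX hG.1).
move=> w1 _; set x := X w1.
pose H y := 2 * (1 - c) ^+ 2 * dotv x x + 2 * s ^+ 2 * dotv (u x) y ^+ 2.
have hq : quadratic_growth (fun y => dotv (u x) y ^+ 2).
  by apply: elipschitz_sqr_growth; exact: elipschitz_dotv.
have hH : quadratic_growth H by apply: growthD; [exact: growth_cst|exact: growthZ].
have EH : gmean P X H <= G x.
  rewrite (gmeanD gX); [|exact: growth_cst|exact: growthZ].
  rewrite gmean_cst (gmeanZ gX)// (gmean_dotv_sqr gX) lerD2l ler_wpM2l//.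
    by rewrite mulr_ge0 ?sqr_ge0.
  rewrite ler_piMr//; have := normal_second_moment_ge R; rewrite -/sigma2; lra.
apply: (@le_trans _ _ (gmean P X H)%:E); last by rewrite lee_fin.
rewrite -(EFin_gmean gX hH); apply: ge0_le_integral => //.
- by move=> w' _; rewrite lee_fin.
- apply/measurable_EFinP.
  have mF := measurable_gaussian_fun gZ hF.1.
  exact: (measurableT_comp mF
    (measurable_fun_pair (measurable_cst w1) (@measurable_id _ _ setT))).
- by apply/measurable_EFinP; exact: (measurable_gaussian_fun gX hH.1).
by move=> w2 _; rewrite lee_fin; exact: ptw.
Qed.

(** The subgradient inequality is one-sided; the negative part of the increment
has the law of the positive one. *)
Lemma increment_sqr_le (c s : R) : 0 < s -> c ^+ 2 + s ^+ 2 = 1 ->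
  V c s <= 4 * (1 - c) ^+ 2 * (n%:R * sigma2) + 4 * s ^+ 2 * sigma2.
Proof.
move=> s0 cs.
pose Fp (z : 'rV[R]_(n + n)) := Num.max 0 (increment f 1 0 c s z) ^+ 2.
pose Fn (z : 'rV[R]_(n + n)) := Num.max 0 (increment f c s 1 0 z) ^+ 2.
have hp : quadratic_growth Fp.
  by apply: elipschitz_sqr_growth; apply: elipschitz_max0; exact: elipschitz_increment.
have hn : quadratic_growth Fn.
  by apply: elipschitz_sqr_growth; apply: elipschitz_max0; exact: elipschitz_increment.
(* The reflection exchanges the two end points of the increment. *)
have Enp : gmean (P \x P)%E Z Fn = gmean (P \x P)%E Z Fp.
  rewrite (gmean_reflection s0 cs hn); apply: eq_Rintegral => w _.
  rewrite /Fn /Fp /Z /increment !row_mxKl !row_mxKr !scale1r !scale0r !addr0.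
  congr (Num.max 0 (f _ - f _) ^+ 2).
  rewrite !scalerDr !scalerN !scalerA addrACA -scalerDl -scalerBl.
  by rewrite -!expr2 cs scale1r (mulrC c s) subrr scale0r addr0.
have -> : V c s = gmean (P \x P)%E Z Fp + gmean (P \x P)%E Z Fn.
  rewrite -(gmeanD gZ)//; apply: eq_Rintegral => w _ /=.
  have -> : Fn (Z w) = Num.max 0 (- increment f 1 0 c s (Z w)) ^+ 2.
    by rewrite /Fn /increment opprB.
  rewrite /Fp; move: (increment _ _ _ _ _ _) => t.
  have [t0|t0] := leP 0 t.
    by rewrite max_l ?oppr_le0// expr0n addr0.
  by rewrite max_r ?oppr_ge0 ?ltW// expr0n add0r sqrrN.
rewrite Enp; have := increment_positive_part c s; rewrite -/Fp; lra.
Qed.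

(** The angle is a right angle halved [k.+1] times. The inequality
[4 ^+ k * s ^+ 2 <= c ^+ 2] records that its tangent is at most [2 ^- k], which
holds since the tangent of half an angle is at most half the tangent. *)
Lemma increment_dyadic (k : nat) : exists c s,
  [/\ 0 < c, 0 < s, c ^+ 2 + s ^+ 2 = 1, 4 ^+ k * s ^+ 2 <= c ^+ 2 &
      V 0 1 <= 4 * 4 ^+ k * V c s].
Proof.
elim: k => [|k [c [s [c0 s0 cs tn hV]]]].
  pose r : R := Num.sqrt (1 / 2).
  have r0 : 0 < r by rewrite sqrtr_gt0; lra.
  have r2 : r ^+ 2 = 1 / 2 by rewrite sqr_sqrtr//; lra.
  exists r, r; split=> //; rewrite ?expr0 ?mul1r ?r2//; first by lra.
  have rr : r ^+ 2 + r ^+ 2 = 1 by rewrite r2; lra.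
  have := increment_doubling r0 r0 rr.
  by rewrite subrr -mulrA -expr2 r2 mulr1 !(mulrA 2) mulr1 divff ?pnatr_eq0.
have c1 : c < 1 by nra.
(* Half-angle formulas. *)
pose c' : R := Num.sqrt ((1 + c) / 2); pose s' : R := Num.sqrt ((1 - c) / 2).
have c'0 : 0 < c' by rewrite sqrtr_gt0; lra.
have s'0 : 0 < s' by rewrite sqrtr_gt0; lra.
have c'2 : c' ^+ 2 = (1 + c) / 2 by rewrite sqr_sqrtr//; lra.
have s'2 : s' ^+ 2 = (1 - c) / 2 by rewrite sqr_sqrtr//; lra.
have cs' : c' ^+ 2 + s' ^+ 2 = 1 by rewrite c'2 s'2; lra.
have Ec : c' ^+ 2 - s' ^+ 2 = c by rewrite c'2 s'2; lra.
have Es : 2 * c' * s' = s.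
  apply/eqP; rewrite -(eqrXn2 (n := 2))// ?mulr_ge0 ?ltW//.
  by rewrite !exprMn c'2 s'2; apply/eqP; nra.
exists c', s'; split=> //.
  rewrite exprS c'2 s'2; set q := 4 ^+ k in tn *.
  have q0 : 0 <= q by rewrite exprn_ge0.
  have hs : s ^+ 2 = (1 - c) * (1 + c) by rewrite -[1 in RHS]cs; nra.
  rewrite hs in tn.
  rewrite -(ler_pM2r (_ : 0 < 1 + c)); last by lra.
  nra.
apply: le_trans hV _; rewrite exprS.
have := increment_doubling c'0 s'0 cs'; rewrite Ec Es => h.
have q0 : 0 <= 4 ^+ k :> R by rewrite exprn_ge0.
rewrite -!mulrA ler_wpM2l// [leRHS]mulrCA ler_wpM2l//.
Qed.

(** Halving [n.+1] times suffices: as [n <= 4 ^ n], the term carrying the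
dimension [n], of fourth order in an angle of order [2 ^- n], is absorbed by the
factor [4 ^ n] lost in the doublings. *)
Lemma increment_independent_le : V 0 1 <= 32 * sigma2.
Proof.
have [c [s [c0 s0 cs tn hV]]] := increment_dyadic n.
apply: le_trans hV _.
have := increment_sqr_le s0 cs.
set q := 4 ^+ n in tn *; have q0 : 0 <= q by rewrite exprn_ge0.
have nq : n%:R <= q.
  by rewrite /q -natrX ler_nat ltnW// ltn_expl.
have S0 : 0 <= sigma2 by have := normal_second_moment_ge R; rewrite -/sigma2; lra.
move=> h; apply: (@le_trans _ _
  (4 * q * (4 * (1 - c) ^+ 2 * (n%:R * sigma2) + 4 * s ^+ 2 * sigma2))).
  by rewrite ler_wpM2l// mulr_ge0.
have n0 : 0 <= n%:R :> R by [].
have qs : q * s ^+ 2 <= 1 by nra.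
have c1 : 1 - c <= s ^+ 2 by nra.
have s2 : 0 <= s ^+ 2 by rewrite sqr_ge0.
have h1 : (1 - c) ^+ 2 <= s ^+ 2 * s ^+ 2 by rewrite expr2 ler_pM//; nra.
have h2 : n%:R * s ^+ 2 <= 1 by rewrite (le_trans _ qs)// ler_wpM2r.
have h3 : q * (1 - c) ^+ 2 * n%:R <= 1.
  apply: (@le_trans _ _ (q * (s ^+ 2 * s ^+ 2) * n%:R)).
    by rewrite ler_wpM2r// ler_wpM2l.
  have -> : q * (s ^+ 2 * s ^+ 2) * n%:R = (q * s ^+ 2) * (n%:R * s ^+ 2) by ring.
  by rewrite mulr_ile1// mulr_ge0.
have -> : 4 * q * (4 * (1 - c) ^+ 2 * (n%:R * sigma2) + 4 * s ^+ 2 * sigma2) =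
   16 * sigma2 * (q * (1 - c) ^+ 2 * n%:R + q * s ^+ 2) by ring.
nra.
Qed.

(** The Gaussian Poincare inequality up to the constant: at a right angle the two
points of the circle are independent copies, whose mean square increment is
twice the variance. *)
Lemma gaussian_variance_le :
  gmean P X (fun x => f x ^+ 2) - gmean P X f ^+ 2 <= 16 * sigma2.
Proof.
have hf := elipschitz_growth lf.
have hf2 := elipschitz_sqr_growth lf.
suff : V 0 1 = 2 * (gmean P X (fun x => f x ^+ 2) - gmean P X f ^+ 2).
  by have := increment_independent_le; lra.
set m1 := gmean P X f; set m2 := gmean P X _.
pose F (z : 'rV[R]_(n + n)) := increment f 1 0 0 1 z ^+ 2.
have hF : quadratic_growth F by apply: elipschitz_sqr_growth; exact: elipschitz_increment.
pose G x := f x ^+ 2 + (- (2 * m1) * f x + m2).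
have hG : quadratic_growth G.
  apply: growthD => //; apply: growthD; [exact: growthZ|exact: growth_cst].
have EG : gmean P X G = 2 * (m2 - m1 ^+ 2).
  rewrite (gmeanD gX hf2); last by apply: growthD; [exact: growthZ|exact: growth_cst].
  rewrite (gmeanD gX (growthZ _ hf) (growth_cst _ _)) (gmeanZ gX _ hf) gmean_cst.
  by rewrite -/m1 -/m2; ring.
(* [G x] is the mean over the second copy of the squared increment from [x]. *)
rewrite -EG; congr fine.
rewrite (fubini_tonelli1 (m1 := P) (m2 := P))/=; last 2 first.
- by apply/measurable_EFinP; exact: (measurable_gaussian_fun gZ hF.1).
- by move=> w; rewrite lee_fin sqr_ge0.
apply: eq_integral => w1 _; rewrite /fubini_F /= -/(F _).
have hH : quadratic_growth (fun y => f (X w1) ^+ 2 + (- (2 * f (X w1)) * f y + f y ^+ 2)).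
  by apply: growthD; [exact: growth_cst|apply: growthD => //; exact: growthZ].
transitivity (\int[P]_w (f (X w1) ^+ 2 + (- (2 * f (X w1)) * f (X w) + f (X w) ^+ 2))%:E)%E.
  apply: eq_integral => w _; rewrite /F /Z /increment row_mxKl row_mxKr.
  by rewrite !scale1r !scale0r addr0 add0r; congr EFin; ring.
rewrite (EFin_gmean gX hH); congr EFin.
rewrite (gmeanD gX (growth_cst _ _) (growthD (growthZ _ hf) hf2)).
rewrite (gmeanD gX (growthZ _ hf) hf2) (gmeanZ gX _ hf) gmean_cst -/m1 -/m2.
by rewrite /G; ring.
Qed.

End Concentration.

(** * Lower bounds for the power of the cone *)

Section ConeStatistics.
Variables (R : realType) (d : measure_display) (T : measurableType d)
  (P : probability T R) (n : nat) (X : T -> 'rV[R]_n) (K : set 'rV[R]_n).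
Hypothesis gX : gaussian_law P X.
Hypothesis hK : closed_convex_cone K.
Implicit Types (u nu x y : 'rV[R]_n).

Let normp x := enorm (metric_proj K x).
Let sigma2 := normal_second_moment R.

Lemma elipschitz_normp nu : elipschitz (fun x => normp (nu + x)).
Proof.
exists 1 => x y; rewrite mul1r.
have h := enorm_projB hK (nu + x) (nu + y).
rewrite opprD addrACA subrr add0r in h; apply: le_trans h.
rewrite lerBlDr /normp -[in leLHS](subrK (metric_proj K (nu + y)) (metric_proj K (nu + x))).
exact: enormD.
Qed.

Lemma elipschitz_normp0 : elipschitz normp.
Proof.
by have := elipschitz_normp 0; congr elipschitz; apply/funext => x; rewrite add0r.
Qed.

Lemma stat_dimE : stat_dim P X K = gmean P X (fun x => normp x ^+ 2).
Proof. by rewrite /stat_dim unlock. Qed.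

Lemma Gamma2E nu : Gamma P X K 2 nu =
  gmean P X (fun x => normp (nu + x) ^+ 2) - gmean P X (fun x => normp x ^+ 2).
Proof.
rewrite /Gamma unlock; congr (fine _ - fine _); apply: eq_integral => w _.
- by rewrite powR_mulrn// enorm_ge0.
- by rewrite powR_mulrn// enorm_ge0.
Qed.

Lemma Gamma1E nu : Gamma P X K 1 nu =
  gmean P X (fun x => normp (nu + x)) - gmean P X normp.
Proof.
rewrite /Gamma unlock; congr (fine _ - fine _); apply: eq_integral => w _.
- by rewrite powRr1// enorm_ge0.
- by rewrite powRr1// enorm_ge0.
Qed.

Let g2 nu : quadratic_growth (fun x => normp (nu + x) ^+ 2).
Proof. by apply: elipschitz_sqr_growth; exact: elipschitz_normp. Qed.

Let g20 : quadratic_growth (fun x => normp x ^+ 2).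
Proof. by apply: elipschitz_sqr_growth; exact: elipschitz_normp0. Qed.

(** Testing the dual formula at [nu + metric_proj K x] bounds the increment of the
squared norm below by [enorm nu ^+ 2] plus a centred linear term in [x]. *)
Lemma Gamma2_ge_sqr nu : K nu -> enorm nu ^+ 2 <= Gamma P X K 2 nu.
Proof.
move=> Knu; rewrite Gamma2E -(gmeanB gX (g2 nu) g20).
pose F x := 2 * dotv nu x + enorm nu ^+ 2.
have gl : quadratic_growth (dotv nu) by apply: elipschitz_growth; exact: elipschitz_dotv.
have gF : quadratic_growth F.
  by apply: growthD; [exact: growthZ|exact: growth_cst].
have <- : gmean P X F = enorm nu ^+ 2.
  rewrite (gmeanD gX (growthZ 2 gl) (growth_cst _ _)) (gmeanZ gX 2 gl).
  by rewrite (gmean_dotv gX) mulr0 add0r gmean_cst.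
apply: (gmean_le gX gF (growthB (g2 nu) g20)) => x.
have := sqr_enorm_proj_ge hK (nu + x) (cone_add hK Knu (metric_proj_in hK x)).
have := dotv_metric_proj hK x.
rewrite /F /normp sqr_enorm; move: (enorm _) (metric_proj K x) => a p.
rewrite !dotvE sqr_enorm (dotvC x nu) (dotvC p nu); lra.
Qed.

Lemma dotv_mean_proj u :
  dotv u (mean_proj P X K) = gmean P X (fun x => dotv u (metric_proj K x)).
Proof.
have gc i : quadratic_growth (fun x => u ord0 i * metric_proj K x ord0 i).
  apply: growthZ; apply: elipschitz_growth; exists 1 => x y; rewrite mul1r.
  apply: le_trans (enorm_projB hK x y).
  have := sqr_coord_le_dotv (metric_proj K x - metric_proj K y) i.
  rewrite -sqr_enorm !mxE; have := enorm_ge0 (metric_proj K x - metric_proj K y); nra.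
rewrite /dotv (gmean_sum gX)//; apply: eq_bigr => i _.
have gi : quadratic_growth (fun x => metric_proj K x ord0 i).
  apply: elipschitz_growth; exists 1 => x y; rewrite mul1r.
  apply: le_trans (enorm_projB hK x y).
  have := sqr_coord_le_dotv (metric_proj K x - metric_proj K y) i.
  rewrite -sqr_enorm !mxE; have := enorm_ge0 (metric_proj K x - metric_proj K y); nra.
by rewrite (gmeanZ gX _ gi) mxE unlock.
Qed.

(** Testing the dual formula at [metric_proj K x] bounds the increment of the
squared norm below by [2 <nu, metric_proj K x>]. *)
Lemma Gamma2_ge_dotv nu : 2 * dotv nu (mean_proj P X K) <= Gamma P X K 2 nu.
Proof.
have gd : quadratic_growth (fun x => dotv nu (metric_proj K x)).
  apply: elipschitz_growth; exists (enorm nu) => x y; rewrite -dotvBr.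
  apply: le_trans (dotv_le_enorm _ _) _; apply: ler_wpM2l; first exact: enorm_ge0.
  exact: enorm_projB.
rewrite Gamma2E dotv_mean_proj -(gmeanB gX (g2 nu) g20) -(gmeanZ gX 2 gd).
apply: (gmean_le gX (growthZ 2 gd) (growthB (g2 nu) g20)) => x.
have := sqr_enorm_proj_ge hK (nu + x) (metric_proj_in hK x).
have := dotv_metric_proj hK x.
rewrite /normp; move: (enorm (metric_proj K (nu + x))) => a.
rewrite !dotvE sqr_enorm; lra.
Qed.

(** The mean of a norm is at most its root mean square, and after the shift by
[nu] it is at least that value up to the variance, which is at most
[16 * sigma2]. *)
Lemma Gamma1_ge nu b : 0 <= b ->
  (Num.sqrt (stat_dim P X K) + b) ^+ 2 <=
    stat_dim P X K + Gamma P X K 2 nu - 16 * sigma2 ->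
  b <= Gamma P X K 1 nu.
Proof.
move=> b0; rewrite stat_dimE Gamma2E Gamma1E.
set D := gmean P X (fun x => normp x ^+ 2).
set A2 := gmean P X (fun x => normp (nu + x) ^+ 2).
set A := gmean P X (fun x => normp (nu + x)); set B := gmean P X normp.
have D0 : 0 <= D by apply: Rintegral_ge0 => w _; rewrite sqr_ge0.
have A0 : 0 <= A by apply: Rintegral_ge0 => w _; exact: enorm_ge0.
have B0 : 0 <= B by apply: Rintegral_ge0 => w _; exact: enorm_ge0.
have gB : quadratic_growth normp := elipschitz_growth elipschitz_normp0.
have BD : B <= Num.sqrt D.
  rewrite -(ler_sqr B0 (sqrtr_ge0 _)) sqr_sqrtr//.
  pose F x := normp x ^+ 2 + (- (2 * B) * normp x + B ^+ 2).
  have : 0 <= gmean P X F.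
    apply: Rintegral_ge0 => w _.
    have -> : F (X w) = (normp (X w) - B) ^+ 2 by rewrite /F; ring.
    exact: sqr_ge0.
  rewrite (gmeanD gX g20 (growthD (growthZ _ gB) (growth_cst _ _))).
  rewrite (gmeanD gX (growthZ _ gB) (growth_cst _ _)) (gmeanZ gX _ gB) gmean_cst.
  rewrite -/B -/D; lra.
have VA : A2 - A ^+ 2 <= 16 * sigma2.
  apply: (@gaussian_variance_le _ _ _ _ _ _ gX _
    (fun x => (normp (nu + x))^-1 *: metric_proj K (nu + x))) => x.
  - move=> y; have := enorm_proj_subgradient hK (nu + x) (nu + y).
    have -> : nu + x - (nu + y) = x - y by rewrite opprD addrACA subrr add0r.
    exact.
  - rewrite dotvZl dotvZr -sqr_enorm -/(normp _).
    have [->|p0] := eqVneq (normp (nu + x)) 0; first by rewrite invr0 !mul0r.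
    by rewrite le_eqVlt; apply/orP; left; apply/eqP; field.
rewrite [D + _]addrC subrK => h.
have {}h : (Num.sqrt D + b) ^+ 2 <= A ^+ 2 by lra.
have : Num.sqrt D + b <= A by rewrite -(ler_sqr (addr_ge0 (sqrtr_ge0 _) b0) A0).
lra.
Qed.

(** By symmetry the positive part carries half of the second moment. *)
Lemma gmean_sqr_pos_dotv u :
  gmean P X (fun x => Num.max 0 (dotv u x) ^+ 2) = sigma2 / 2 * dotv u u.
Proof.
have gp v : quadratic_growth (fun x => Num.max 0 (dotv v x) ^+ 2).
  by apply: elipschitz_sqr_growth; apply: elipschitz_max0; exact: elipschitz_dotv.
have E : gmean P X (fun x => Num.max 0 (dotv u x) ^+ 2) =
         gmean P X (fun x => Num.max 0 (dotv (- u) x) ^+ 2).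
  rewrite (gmean_flip gX predT (gp u)); apply: eq_Rintegral => w _.
  have -> : flip predT (X w) = - X w by apply/rowP => i; rewrite !mxE.
  by rewrite dotvNr dotvNl.
suff : gmean P X (fun x => Num.max 0 (dotv u x) ^+ 2) +
       gmean P X (fun x => Num.max 0 (dotv (- u) x) ^+ 2) = sigma2 * dotv u u.
  by rewrite -E; lra.
rewrite -(gmeanD gX (gp u) (gp (- u))) -(gmean_dotv_sqr gX).
apply: eq_Rintegral => w _; rewrite dotvNl; move: (dotv _ _) => t.
have [t0|t0] := leP 0 t.
  by rewrite max_l ?oppr_le0// expr0n addr0.
by rewrite max_r ?oppr_ge0 ?ltW// expr0n add0r sqrrN.
Qed.

(** The cone contains the orthogonal sum of the subspace and of the half-line
spanned by [nu], whose statistical dimension exceeds that of the subspace by a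
positive constant. *)
Lemma stat_dim_gap (U : {vspace 'rV[R]_n}) nu :
  [set x | x \in U] `<=` K -> K nu -> nu != 0 ->
  (forall x, x \in U -> dotv nu x = 0) ->
  sigma2 / 2 <= stat_dim P X K - stat_dim P X [set x | x \in U].
Proof.
move=> UK Knu nu0 orth.
set L := [set x | x \in U] in UK *.
have hL : closed_convex_cone L := subspace_closed_convex_cone U.
have t0 : 0 < enorm nu.
  by rewrite lt_def enorm_ge0 andbT; apply: contra nu0 => /eqP/enorm_eq0 ->.
have cone : forall (t : R) x, 0 <= t -> K x -> K (t *: x) by have [] := hK.
have [v [Kv vv vU]] : exists v,
    [/\ K v, dotv v v = 1 & forall x, x \in U -> dotv v x = 0].
  exists ((enorm nu)^-1 *: nu); split.
  - by apply: cone => //; rewrite invr_ge0 ltW.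
  - by rewrite dotvZl dotvZr -sqr_enorm; field; rewrite gt_eqF.
  - by move=> x xU; rewrite dotvZl orth// mulr0.
have -> : stat_dim P X L = gmean P X (fun x => enorm (metric_proj L x) ^+ 2).
  by rewrite /stat_dim unlock.
have -> : sigma2 / 2 = gmean P X (fun x => Num.max 0 (dotv v x) ^+ 2).
  by rewrite gmean_sqr_pos_dotv vv mulr1.
rewrite stat_dimE lerBrDr.
have gp : quadratic_growth (fun x => Num.max 0 (dotv v x) ^+ 2).
  by apply: elipschitz_sqr_growth; apply: elipschitz_max0; exact: elipschitz_dotv.
have gLp : quadratic_growth (fun x => enorm (metric_proj L x) ^+ 2).
  apply: elipschitz_sqr_growth; exists 1 => x y; rewrite mul1r.
  apply: le_trans (enorm_projB hL x y).
  rewrite lerBlDr -[in leLHS](subrK (metric_proj L y) (metric_proj L x)).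
  exact: enormD.
rewrite -(gmeanD gX gp gLp); apply: (gmean_le gX) => [||x]; [exact: growthD|exact: g20|].
set t := Num.max 0 _; set p := metric_proj L x.
have pU : p \in U by exact: (metric_proj_in hL x).
have t0' : 0 <= t by rewrite le_max lexx.
have Kpt : K (p + t *: v) by apply: cone_add => //; [exact: UK|exact: cone].
apply: le_trans (sqr_enorm_proj_ge hK x Kpt).
have vp : dotv v p = 0 by exact: vU.
have tz : t * dotv v x = t ^+ 2.
  rewrite /t; have [z0|z0] := leP 0 (dotv v x); first by rewrite expr2.
  by rewrite mul0r expr0n.
have := dotv_metric_proj hL x; rewrite -/p => px.
rewrite !dotvE px (dotvC x v) tz vp (dotvC p v) vp vv sqr_enorm; lra.
Qed.

(** Each term of the threshold calls for one lower bound. If the first is the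
smaller, [enorm nu] is at least [M] times the fourth root of the statistical
dimension, and the quadratic bound applies. If the second is, the infimum is
positive and at most its value at the direction of [nu], so the linear bound
applies. *)
Lemma Gamma2_ge_threshold nu M : K nu -> nu != 0 -> 0 < stat_dim P X K -> 2 <= M ->
  (M%:E <= (enorm nu)%:E / threshold P X K)%E ->
  2 * M * Num.sqrt (stat_dim P X K) <= Gamma P X K 2 nu.
Proof.
move=> Knu nu0 D0 M2; set D := stat_dim P X K in D0 *.
have t0 : 0 < enorm nu.
  by rewrite lt_def enorm_ge0 andbT; apply: contra nu0 => /eqP/enorm_eq0 ->.
have sD : 0 < Num.sqrt D by rewrite sqrtr_gt0.
have a0 : 0 < D `^ (1 / 4) by rewrite powR_gt0.
have a2 : (D `^ (1 / 4)) ^+ 2 = Num.sqrt D.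
  rewrite -powR_mulrn ?powR_ge0// -powRrM -powR12_sqrt ?ltW//.
  by congr powR; field.
have key (tau : R) : 0 < tau -> (M%:E <= (enorm nu)%:E / tau%:E)%E -> M * tau <= enorm nu.
  by move=> tau0; rewrite inver gt_eqF// -EFinM lee_fin ler_pdivlMr.
have caseA : M * D `^ (1 / 4) <= enorm nu -> 2 * M * Num.sqrt D <= Gamma P X K 2 nu.
  move=> h; apply: le_trans (Gamma2_ge_sqr Knu).
  have : (M * D `^ (1 / 4)) ^+ 2 <= enorm nu ^+ 2.
    have h0 : 0 <= M * D `^ (1 / 4) by rewrite mulr_ge0 ?ltW//; lra.
    by rewrite (ler_sqr h0 (enorm_ge0 _)).
  rewrite exprMn a2; nra.
rewrite /threshold /= -/D.
set m := ereal_inf _; set r := (Order.max _ m).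
have Hm : (m <= (dotv ((enorm nu)^-1 *: nu) (mean_proj P X K))%:E)%E.
  apply: ereal_inf_lbound => /=; exists ((enorm nu)^-1 *: nu) => //; split.
    by have [_ _ _] := hK; apply => //; rewrite invr_ge0 ltW.
  by rewrite enormZ gtr0_norm ?invr_gt0// mulVf ?gt_eqF.
(* A nonpositive infimum makes the second term infinite. *)
have [m0|m0] := leP m 0%E.
  have -> : r = 0%E by exact/max_idPl.
  rewrite inve0 gt0_muley ?lte_fin ?powR_gt0// (min_idPl (leey _)).
  by move=> /key h; apply: caseA; exact: h.
have {r}-> : r = m by exact/max_idPr/ltW.
case: m m0 Hm => [r| |] //.
rewrite lte_fin lee_fin => r0 Hm.
have q0 : 0 < D `^ (1 / 2) / r by rewrite divr_gt0 ?powR_gt0.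
rewrite inver gt_eqF// -EFinM.
have [ab|ab] := leP (D `^ (1 / 4)) (D `^ (1 / 2) / r).
  have ab' : ((D `^ (1 / 4))%:E <= (D `^ (1 / 2) / r)%:E)%E by rewrite lee_fin.
  rewrite (min_idPl ab') => /key h.
  by apply: caseA; exact: h.
have ab' : ((D `^ (1 / 2) / r)%:E <= (D `^ (1 / 4))%:E)%E by rewrite lee_fin ltW.
rewrite (min_idPr ab') => /(key _ q0) h.
apply: le_trans (Gamma2_ge_dotv nu).
have sE : D `^ (1 / 2) = Num.sqrt D by rewrite mul1r powR12_sqrt// ltW.
rewrite sE mulrA ler_pdivrMr// in h.
rewrite dotvZl mulrC ler_pdivlMr// in Hm.
rewrite -mulrA ler_wpM2l//; nra.
Qed.

End ConeStatistics.

(** * Divergence of the normalized power *)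

(** A non-asymptotic form of the two limits. The variance is below 86, as
[16 * (16 / 3) < 86]. Let [D] be the statistical dimension of [K]. As
[Gamma P X K 2 nu >= 2 * M * sqrt D], the lower bound on [Gamma P X K 1 nu] needs
[2 * (M - A) * sqrt D >= A ^+ 2 + 86], which the choice of [M] ensures for
[sqrt D >= 2 / 5]. *)
Lemma Gamma_ratio_ge (R : realType) d (T : measurableType d) (P : probability T R)
    n (X : T -> 'rV[R]_n) (K : set 'rV[R]_n) (U : {vspace 'rV[R]_n})
    (nu : 'rV[R]_n) (A M : R) :
  gaussian_law P X -> closed_convex_cone K -> [set x | x \in U] `<=` K ->
  K nu -> (forall x, x \in U -> dotv nu x = 0) ->
  0 <= A -> 2 + A + 2 * (A ^+ 2 + 86) <= M ->
  (M%:E <= (enorm nu)%:E / threshold P X K)%E ->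
  A <= Gamma P X K 2 nu /
         (stat_dim P X K - stat_dim P X [set x | x \in U]) `^ (1 / 2) /\
  A <= Gamma P X K 1 nu /
         Num.sqrt (1 - stat_dim P X [set x | x \in U] / stat_dim P X K).
Proof.
move=> gX hK UK Knu orth A0 AM hM.
have nu0 : nu != 0.
  apply/eqP => nu0; move: hM; rewrite nu0 /enorm dotv0l sqrtr0 mul0e lee_fin.
  have := sqr_ge0 A; lra.
have gap := stat_dim_gap gX hK UK Knu nu0 orth.
set D := stat_dim P X K in gap *; set D0 := stat_dim P X _ in gap *.
have s1 := normal_second_moment_ge R; have s2 := normal_second_moment_le R.
have D00 : 0 <= D0.
  by rewrite /D0 /stat_dim unlock; apply: Rintegral_ge0 => w _; exact: sqr_ge0.
have Dpos : 0 < D by lra.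
have A2 := sqr_ge0 A.
have G2 : 2 * M * Num.sqrt D <= Gamma P X K 2 nu.
  by apply: Gamma2_ge_threshold => //; lra.
(* The gap is at least half the second moment, hence [D >= 1 / 6 > (2 / 5) ^+ 2]. *)
have sD : 2 / 5 <= Num.sqrt D.
  have h0 : 0 <= 2 / 5 :> R by lra.
  rewrite -(ler_sqr h0 (sqrtr_ge0 _)) sqr_sqrtr ?ltW//; lra.
have sDD : Num.sqrt D ^+ 2 = D by rewrite sqr_sqrtr// ltW.
have Dgap : 0 < D - D0 by lra.
split.
  rewrite mul1r (powR12_sqrt (ltW Dgap)) ler_pdivlMr ?sqrtr_gt0//.
  have h : Num.sqrt (D - D0) <= Num.sqrt D by rewrite ler_sqrt; [lra|exact: ltW].
  apply: le_trans G2; apply: (@le_trans _ _ (A * Num.sqrt D)); first exact: ler_wpM2l.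
  by rewrite ler_wpM2r ?sqrtr_ge0//; lra.
have q0 : 0 < 1 - D0 / D by rewrite subr_gt0 ltr_pdivrMr//; lra.
have q1 : Num.sqrt (1 - D0 / D) <= 1.
  rewrite -[leRHS]sqrtr1 ler_sqrt// gerBl; exact: divr_ge0 D00 (ltW Dpos).
rewrite ler_pdivlMr ?sqrtr_gt0//; apply: (@le_trans _ _ A).
  by rewrite ler_piMr.
apply: Gamma1_ge => //; rewrite -/D sqrrD sDD; nra.
Qed.

Unset Implicit Arguments.
Set Strict Implicit.
Set Printing Implicit Defensive.

Theorem corollary3p11 (R : realType)
    (d : nat -> measure_display)
    (T : forall n : nat, measurableType (d n))
    (P : forall n : nat, probability (T n) R)
    (xi : forall n : nat, T n -> 'rV[R]_n)
    (K0 : forall n : nat, {vspace 'rV[R]_n})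
    (K : forall n : nat, set 'rV[R]_n)
    (mu : forall n : nat, 'rV[R]_n)
    (xi_gauss : forall n : nat, standard_gaussian (P n) (xi n))
    (K_cone : forall n : nat, closed_convex_cone (K n))
    (K0_sub_K : forall n : nat, [set x | x \in K0 n] `<=` K n)
    (mu_K : forall n : nat, K n (mu n)) :
  let L (n : nat) : set 'rV[R]_n := [set x | x \in K0 n] in
  let nu (n : nat) : 'rV[R]_n := mu n - metric_proj (L n) (mu n) in
  let delta (n : nat) : R := stat_dim (P n) (xi n) (K n) in
  let delta0 (n : nat) : R := stat_dim (P n) (xi n) (L n) in
  much_greater (fun n => (enorm (nu n))%:E)
               (fun n => threshold (P n) (xi n) (K n)) ->
  (Gamma (P n) (xi n) (K n) 2 (nu n) / (delta n - delta0 n) `^ (1 / 2))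
    @[n --> \oo] --> +oo /\
  (Gamma (P n) (xi n) (K n) 1 (nu n) / Num.sqrt (1 - delta0 n / delta n))
    @[n --> \oo] --> +oo.
Proof.
move=> L nu delta delta0 hgt.
have ratio A : 0 <= A -> \forall n \near \oo,
    A <= Gamma (P n) (xi n) (K n) 2 (nu n) / (delta n - delta0 n) `^ (1 / 2) /\
    A <= Gamma (P n) (xi n) (K n) 1 (nu n) / Num.sqrt (1 - delta0 n / delta n).
  move=> A0; have /cvgeyPge/(_ (2 + A + 2 * (A ^+ 2 + 86))) := hgt.
  apply: filterS => n hn.
  have hL := subspace_closed_convex_cone (K0 n).
  apply: (Gamma_ratio_ge (standard_gaussian_law (xi_gauss n)) (K_cone n)
    (K0_sub_K n) _ _ A0 (lexx _) hn).
  - apply: cone_add => //; apply: K0_sub_K => /=; rewrite memvN.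
    exact: (metric_proj_in hL (mu n)).
  - by move=> x xK0; exact: subspace_proj_orth.
split; apply/cvgryPge => A.
- apply: filterS (ratio (Num.max 0 A) _); last by rewrite le_max lexx.
  by move=> n [h _]; apply: le_trans h; rewrite le_max lexx orbT.
- apply: filterS (ratio (Num.max 0 A) _); last by rewrite le_max lexx.
  by move=> n [_ h]; apply: le_trans h; rewrite le_max lexx orbT.
Qed.
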